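(* Let $a<b<\infty$, $\sigma\in\mathbb{R}$, $\rho\neq 0$, let $m$ be a positive integer and $m-1<\alpha\le m$. If $\psi\in\Omega^m_{\sigma,\rho}[a,b]$, then $$ {}_{\sigma}D_{a}^{\alpha,\rho}\psi(t)=e^{-\sigma t^\rho}\,D_{a}^{\alpha,\rho}\big(e^{\sigma t^\rho}\psi(t)\big). $$
   Context: Function space: $\Omega_{\sigma,\rho}^m[a,b]=\{\psi: e^{\sigma t^{\rho}}t^{1-\rho}\psi(t)\in AC^m[a,b]\}$, where $AC^m[a,b]$ is the set of functions whose $(m-1)$-st derivative exists and is absolutely continuous on $[a,b]$. Differential operators: $D^{m,\rho}=\big(\frac{t^{1-\rho}}{\rho}\frac{d}{dt}\big)^m$ and ${}_\sigma D^{m,\rho}=\big(\frac{t^{1-\rho}}{\rho}\frac{d}{dt}+\sigma\big)^m$ ($m$-fold compositions). Katugampola operators: for $\gamma>0$, $I_a^{\gamma,\rho}\psi(t)=\frac{\rho}{\Gamma(\gamma)}\int_a^t (t^\rho-s^\rho)^{\gamma-1}\psi(s)s^{\rho-1}\,ds$, $I_a^{0,\rho}$ is the identity, and for $m-1<\alpha\le m$, $D_a^{\alpha,\rho}\psi=D^{m,\rho}I_a^{m-\alpha,\rho}\psi$ (Riemann-Liouville type). Generalized substantial operators: for $\gamma>0$, ${}_\sigma I_a^{\gamma,\rho}\psi(t)=\frac{\rho}{\Gamma(\gamma)}\int_a^t (t^\rho-s^\rho)^{\gamma-1}e^{-\sigma(t^\rho-s^\rho)}s^{\rho-1}\psi(s)\,ds$,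 ${}_\sigma I_a^{0,\rho}$ is the identity, and for $m-1<\alpha\le m$, ${}_\sigma D_a^{\alpha,\rho}\psi={}_\sigma D^{m,\rho}\,{}_\sigma I_a^{m-\alpha,\rho}\psi$ (Riemann-Liouville type). *)

(* Defs.v *)
From HB Require Import structures.
From mathcomp Require Import all_boot all_order all_algebra.
From mathcomp Require Import all_classical all_reals all_analysis.
From mathcomp Require Import complex.

Set Implicit Arguments.
Unset Strict Implicit.
Unset Printing Implicit Defensive.

Import Order.TTheory GRing.Theory Num.Theory.
Import numFieldNormedType.Exports.

Local Open Scope classical_set_scope.
Local Open Scope ring_scope.
Local Open Scope complex_scope.

(* All differentiation is relative to [a, b]: the limits below only involve
   points of [a, b], so that derivatives are one-sided at a and b and values
   outside [a, b] are irrelevant. *)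

Definition derivable_on {R : realType} (a b : R) (f : R -> R) (t : R) : Prop :=
  cvg ((f s - f t) / (s - t) @[s --> within `[a, b] t^']).

Definition derive_on {R : realType} (a b : R) (f : R -> R) (t : R) : R :=
  lim ((f s - f t) / (s - t) @[s --> within `[a, b] t^']).

Definition abs_continuous_on {R : realType} (a b : R) (f : R -> R) : Prop :=
  forall eps : R, 0 < eps -> exists2 delta : R, 0 < delta &
    forall (n : nat) (u v : 'I_n -> R),
      (forall i, [/\ a <= u i, u i <= v i & v i <= b]) ->
      trivIset setT (fun i => `]u i, v i[%classic) ->
      \sum_(i < n) (v i - u i) < delta ->
      \sum_(i < n) `|f (v i) - f (u i)| < eps.

Definition ACm {R : realType} (m : nat) (a b : R) (f : R -> R) : Prop :=
  (forall k t, (k < m.-1)%N -> t \in `[a, b] ->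
     derivable_on a b (iter k (derive_on a b) f) t) /\
  abs_continuous_on a b (iter m.-1 (derive_on a b) f).

(* Principal value of x ^ c for real x and c. It is needed for the kernels
   below: when t ^ rho < s ^ rho (e.g. rho < 0 and 0 < s < t) the powers of
   t ^ rho - s ^ rho with exponent gamma - 1 are genuinely complex. When
   s ^ rho <= t ^ rho they are real. *)
Definition cpow {R : realType} (x c : R) : R[i] :=
  (`|x| `^ c)%:C * (if 0 <= x then 1 else cos (c * pi) +i* sin (c * pi)).

(* The real power x ^ c. For x < 0 it is only meaningful for integer c, where
   cos (c * pi) = (-1) ^ c; it is only used under that restriction. *)
Definition rpow {R : realType} (x c : R) : R :=
  if 0 <= x then x `^ c else `|x| `^ c * cos (c * pi).

(* The points where both t ^ rho and t ^ (1 - rho) have a value and the vector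
   field (t ^ (1 - rho) / rho) d/dt is nonsingular. *)
Definition regular_point {R : realType} (rho t : R) : Prop :=
  t != 0 \/ rho = 1.

(* At t = 0 and for rho != 1, t ^ rho (if rho < 0) or t ^ (1 - rho) (if
   1 < rho) has no value, and the weighted function is taken up to its AC^m
   extension. If all points of [a, b] are regular, this says exactly that the
   weighted function belongs to AC^m[a, b]. *)
Definition Omega {R : realType} (m : nat) (sigma rho a b : R) (psi : R -> R) :
    Prop :=
  exists2 g : R -> R, ACm m a b g &
    forall t, t \in `[a, b] -> regular_point rho t ->
      g t = expR (sigma * rpow t rho) * rpow t (1 - rho) * psi t.

Definition cintegrable {R : realType} (D : set R) (f : R -> R[i]) : Prop :=
  lebesgue_measure.-integrable D (EFin \o (fun s => complex.Re (f s))) /\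
  lebesgue_measure.-integrable D (EFin \o (fun s => complex.Im (f s))).

Definition cintegral {R : realType} (D : set R) (f : R -> R[i]) : R[i] :=
  (\int[lebesgue_measure]_(s in D) complex.Re (f s)) +i*
  (\int[lebesgue_measure]_(s in D) complex.Im (f s)).

Definition cderivable_on {R : realType} (a b : R) (f : R -> R[i]) (t : R) :
    Prop :=
  derivable_on a b (fun s => complex.Re (f s)) t /\
  derivable_on a b (fun s => complex.Im (f s)) t.

Definition cderive_on {R : realType} (a b : R) (f : R -> R[i]) (t : R) : R[i] :=
  derive_on a b (fun s => complex.Re (f s)) t +i*
  derive_on a b (fun s => complex.Im (f s)) t.

Definition Gamma {R : realType} (x : R) : R :=
  \int[lebesgue_measure]_(y in `]0, +oo[) (y `^ (x - 1) * expR (- y)).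

Definition katugampola_kernel {R : realType} (gamma rho : R) (psi : R -> R)
    (t s : R) : R[i] :=
  cpow (rpow t rho - rpow s rho) (gamma - 1) * (psi s * rpow s (rho - 1))%:C.

Definition katugampola_I {R : realType} (gamma rho a : R) (psi : R -> R)
    (t : R) : R[i] :=
  if gamma == 0 then (psi t)%:C
  else (rho / Gamma gamma)%:C *
       cintegral `[a, t] (katugampola_kernel gamma rho psi t).

Definition katugampola_I_exists {R : realType} (gamma rho a : R)
    (psi : R -> R) (t : R) : Prop :=
  gamma = 0 \/ cintegrable `[a, t] (katugampola_kernel gamma rho psi t).

Definition substantial_kernel {R : realType} (sigma gamma rho : R)
    (psi : R -> R) (t s : R) : R[i] :=
  cpow (rpow t rho - rpow s rho) (gamma - 1) *
  (expR (- sigma * (rpow t rho - rpow s rho)) * rpow s (rho - 1) * psi s)%:C.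

Definition substantial_I {R : realType} (sigma gamma rho a : R)
    (psi : R -> R) (t : R) : R[i] :=
  if gamma == 0 then (psi t)%:C
  else (rho / Gamma gamma)%:C *
       cintegral `[a, t] (substantial_kernel sigma gamma rho psi t).

Definition substantial_I_exists {R : realType} (sigma gamma rho a : R)
    (psi : R -> R) (t : R) : Prop :=
  gamma = 0 \/ cintegrable `[a, t] (substantial_kernel sigma gamma rho psi t).

Definition kat_step {R : realType} (rho a b : R) (f : R -> R[i]) (t : R) :
    R[i] :=
  (rpow t (1 - rho) / rho)%:C * cderive_on a b f t.

Definition subst_step {R : realType} (sigma rho a b : R) (f : R -> R[i])
    (t : R) : R[i] :=
  (rpow t (1 - rho) / rho)%:C * cderive_on a b f t + sigma%:C * f t.

(* [derive_on] and [cintegral] are total. [iter_exists a b L dom n f t] says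
   that the n-fold composition of the first-order operator L, applied to the
   partial function f of domain dom, is defined at t: each intermediate
   function is defined on a neighbourhood of t in [a, b] and the last one is
   differentiable at t. *)
Fixpoint iter_exists {R : realType} (a b : R)
    (L : (R -> R[i]) -> R -> R[i]) (dom : R -> Prop) (n : nat)
    (f : R -> R[i]) (t : R) : Prop :=
  if n is k.+1 then
    (\forall s \near within `[a, b] (nbhs t), iter_exists a b L dom k f s) /\
    cderivable_on a b (iter k L f) t
  else dom t.

Definition katugampola_D {R : realType} (m : nat) (alpha rho a b : R)
    (psi : R -> R) : R -> R[i] :=
  iter m (kat_step rho a b) (katugampola_I (m%:R - alpha) rho a psi).

Definition katugampola_D_exists {R : realType} (m : nat) (alpha rho a b : R)
    (psi : R -> R) : R -> Prop :=
  iter_exists a b (kat_step rho a b)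
    (katugampola_I_exists (m%:R - alpha) rho a psi) m
    (katugampola_I (m%:R - alpha) rho a psi).

Definition substantial_D {R : realType} (m : nat) (sigma alpha rho a b : R)
    (psi : R -> R) : R -> R[i] :=
  iter m (subst_step sigma rho a b)
    (substantial_I sigma (m%:R - alpha) rho a psi).

Definition substantial_D_exists {R : realType} (m : nat)
    (sigma alpha rho a b : R) (psi : R -> R) : R -> Prop :=
  iter_exists a b (subst_step sigma rho a b)
    (substantial_I_exists sigma (m%:R - alpha) rho a psi) m
    (substantial_I sigma (m%:R - alpha) rho a psi).

(* Main.v *)
Require Import Defs.
From HB Require Import structures.
From mathcomp Require Import all_boot all_order all_algebra.
From mathcomp Require Import all_classical all_reals all_analysis.
From mathcomp Require Import measurable_realfun complex ring lra.

(** Conjugation. With h t = t ^ rho, the substantial kernel at (t, s) is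
    exp (- sigma h t) times the Katugampola kernel of exp (sigma h) psi
    ([substantial_kernelE]), so the two fractional integrals exist together and
    differ by the factor E = exp (- sigma h). The operator
    (t ^ (1 - rho) / rho) d/dt maps h to 1, hence E to - sigma E, and by the product
    rule the operator with + sigma, applied to E f, is E times the operator without
    sigma applied to f. Induction on the number of applications, carried out
    together with the existence of the intermediate functions on neighbourhoods,
    gives the first two assertions ([iter_conjugation]).

    Existence. It remains to see that the Katugampola derivative of
    phi = exp (sigma h) psi exists almost everywhere when every point of [a, b] is
    regular. Then H = eps h is increasing for a sign eps, with a smooth positive
    derivative dH, and the complex kernel is a constant phase times a real one
    ([katugampola_I_fractional]); phi is C^(m-1) with an absolutely continuous
    derivative of order m - 1, because it differs from the weighted function of the
    hypothesis by a smooth factor. Let g = m - alpha. If g = 0 nothing is integrated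
    and this regularity is enough. Otherwise let F_phi t be the integral
    of (H t - H s) ^ (g - 1) dH s phi s over [a, t]. If phi is the primitive of an
    integrable k, two exchanges of integrals show that F_phi t is
    phi a (H t - H a) ^ g / g plus the primitive of an integrable function
    ([fractional_integral_primitive]); when k is continuous, that function is
    dH F_(k / dH). Therefore differentiating with respect to H maps F_phi to
    phi a (H - H a) ^ (g - 1) + F_(D phi), where D is the derivative with respect
    to H: m - 1 derivatives exist at every interior point, and the last one exists
    almost everywhere by the Lebesgue differentiation theorem
    ([iter_derivable_fractional_integral]).

    Absolutely continuous functions are primitives. The last step uses that an
    absolutely continuous function is the primitive of an integrable function
    ([AC_primitive]). It is a difference of two nondecreasing ones, namely its total
    variation and the total variation minus itself; for a nondecreasing absolutely
    continuous function the Stieltjes measure is dominated by the Lebesgue measure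
    ([null_stieltjes]), and the Radon-Nikodym theorem provides the integrand. *)

Import Order.TTheory GRing.Theory Num.Theory.
Import numFieldNormedType.Exports.

Local Open Scope classical_set_scope.
Local Open Scope ring_scope.
Local Open Scope complex_scope.

Set Implicit Arguments.
Unset Strict Implicit.
Unset Printing Implicit Defensive.

(** * Absolute continuity along chains of intervals *)

Section Chains.
Context {R : realType}.
Implicit Types (a b lo : R) (f : R -> R) (s : seq (R * R)).

(** Listing the intervals from left to right makes disjointness a local condition
    and lets two families be concatenated, which arbitrary disjoint families do
    not. *)
Fixpoint chain b lo s : bool :=
  if s is p :: s' then [&& lo <= p.1, p.1 <= p.2 & chain b p.2 s'] else lo <= b.

Definition lengths s : R := \sum_(p <- s) (p.2 - p.1).
Definition oscillation f s : R := \sum_(p <- s) `|f p.2 - f p.1|.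

Definition chain_AC a b f := forall eps : R, 0 < eps ->
  exists2 delta : R, 0 < delta &
    forall s, chain b a s -> lengths s < delta -> oscillation f s < eps.

Lemma chain_le b lo s : chain b lo s -> lo <= b.
Proof.
by elim: s lo => [|p s IH] lo //= /and3P[h1 h2 /IH]; exact/le_trans/(le_trans h1).
Qed.

Lemma chain_weaken b lo lo' s : lo' <= lo -> chain b lo s -> chain b lo' s.
Proof.
case: s => [|p s] /= h; first exact: le_trans.
by move=> /and3P[h1 -> ->]; rewrite (le_trans h h1).
Qed.

Lemma chain_nth b lo s i : chain b lo s -> (i < size s)%N ->
  [/\ lo <= (nth (0, 0) s i).1, (nth (0, 0) s i).1 <= (nth (0, 0) s i).2 &
      (nth (0, 0) s i).2 <= b].
Proof.
elim: s lo i => [//|p s IH] lo [|i] /= /and3P[h1 h2 h3] hi.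
  by split=> //; exact: chain_le h3.
by have [k1 k2 k3] := IH _ i h3 hi; split=> //; apply: le_trans k1; apply: le_trans h2.
Qed.

Lemma chain_nth_lt b lo s i j : chain b lo s -> (i < j)%N -> (j < size s)%N ->
  (nth (0, 0) s i).2 <= (nth (0, 0) s j).1.
Proof.
elim: s lo i j => [//|p s IH] lo [|i] [//|j] /= /and3P[h1 h2 h3] ij hj.
  by have [] := chain_nth h3 hj.
exact: (IH p.2 i j).
Qed.

(** The intervals of a chain have disjoint interiors. *)
Lemma abs_continuous_on_chain a b f : abs_continuous_on a b f -> chain_AC a b f.
Proof.
move=> acf eps /acf[delta d0 H]; exists delta => // s cs; rewrite /lengths /oscillation.
rewrite !(big_nth (0, 0)) !big_mkord.
apply: (H _ (fun i => (nth (0, 0) s i).1) (fun i => (nth (0, 0) s i).2)).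
  by move=> i; apply: chain_nth cs _.
have disj (i j : 'I_(size s)) x : x \in `](nth (0, 0) s i).1, (nth (0, 0) s i).2[ ->
    x \in `](nth (0, 0) s j).1, (nth (0, 0) s j).2[ -> (i < j)%N -> False.
  rewrite !in_itv /= => /andP[h1 h2] /andP[h3 h4] ij.
  have := chain_nth_lt cs ij (ltn_ord j).
  by rewrite leNgt => /negP; apply; exact: lt_trans h3 h2.
move=> i j _ _ [x [xi xj]]; apply: val_inj; case: (ltngtP i j) => // ij.
  by case: (disj i j x).
by case: (disj j i x).
Qed.

Lemma chain_AC_sub a b f g : chain_AC a b f -> chain_AC a b g ->
  chain_AC a b (fun x => f x - g x).
Proof.
move=> acf acg e e0.
have e20 : 0 < e / 2 by rewrite divr_gt0.
have [d1 d10 H1] := acf _ e20; have [d2 d20 H2] := acg _ e20.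
exists (Num.min d1 d2); first by rewrite lt_min d10.
move=> s cs; rewrite lt_min => /andP[l1 l2]; rewrite (splitr e).
apply: le_lt_trans (ltrD (H1 _ cs l1) (H2 _ cs l2)).
rewrite /oscillation -big_split /=; apply: ler_sum => p _.
apply: le_trans (ler_normB _ _); rewrite le_eqVlt; apply/orP; left; apply/eqP.
by congr `|_|; ring.
Qed.

Fixpoint cells u (l : seq R) : seq (R * R) :=
  if l is x :: l' then (u, x) :: cells x l' else [::].

Lemma chain_cells b u l s : path <%O u l -> chain b (last u l) s ->
  chain b u (cells u l ++ s).
Proof.
by elim: l u => [|x l IH] u //= /andP[ux pl] cs; rewrite lexx (ltW ux) IH.
Qed.

Lemma lengths_cells u l : lengths (cells u l) = last u l - u.
Proof.
elim: l u => [|x l IH] u /=; first by rewrite /lengths big_nil subrr.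
by rewrite /lengths big_cons /= -/(lengths _) IH; ring.
Qed.

Lemma oscillation_cons f p s :
  oscillation f (p :: s) = `|f p.2 - f p.1| + oscillation f s.
Proof. by rewrite /oscillation big_cons. Qed.

Lemma oscillation_cells f b u l : oscillation f (cells u l) = variation u b f l.
Proof.
elim: l u => [|x l IH] u /=; rewrite /oscillation /variation /=.
  by rewrite big_nil big_geq.
rewrite big_cons /= -/(oscillation _ _) IH big_nat_recl //=.
Qed.

Lemma lengths_cat s1 s2 : lengths (s1 ++ s2) = lengths s1 + lengths s2.
Proof. by rewrite /lengths big_cat. Qed.

Lemma oscillation_cat f s1 s2 :
  oscillation f (s1 ++ s2) = oscillation f s1 + oscillation f s2.
Proof. by rewrite /oscillation big_cat. Qed.

Notation TV := total_variation.

(** A partition of an interval shorter than the delta attached to 1 is a chain of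
    total length less than delta, so [f] varies by at most 1 there; finitely many
    such intervals cover [a, b]. *)
Lemma chain_AC_total_variation_fin a b f : a <= b -> chain_AC a b f ->
  TV a b f \is a fin_num.
Proof.
move=> ab acf; have [d d0 H] := acf 1 ltr01.
(* half of [d]: intervals must be strictly shorter than [d] *)
pose h := d / 2.
have h0 : 0 < h by rewrite divr_gt0.
have short u v : a <= u -> u <= v -> v <= b -> v - u < d -> (TV u v f <= 1%:E)%E.
  move=> au uv vb vud; apply: ge_ereal_sup => _ [_ [l [pl /eqP lv] <-] <-].
  rewrite lee_fin -(oscillation_cells f v u l) ltW //; apply: H.
    rewrite -[cells u l]cats0; apply: chain_weaken au _.
    by apply: chain_cells => //=; rewrite lv.
  by rewrite lengths_cells lv.
have main n : a + n%:R * h <= b -> (TV a (a + n%:R * h)%R f <= n%:R%:E)%E.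
  elim: n => [|n IH] hn; first by rewrite mul0r addr0 total_variationxx.
  have e1 : a + n.+1%:R * h = a + n%:R * h + h by rewrite -natr1; ring.
  have hn' : a + n%:R * h <= b by rewrite (le_trans _ hn) // e1 lerDl ltW.
  rewrite (@total_variationD _ _ _ (a + n%:R * h)); last 2 first.
  - by rewrite lerDl mulr_ge0 // ltW.
  - by rewrite e1 lerDl ltW.
  rewrite -natr1 EFinD; apply: leeD; first exact: IH.
  apply: short => //.
  - by rewrite lerDl mulr_ge0 // ltW.
  - by rewrite natr1 e1 lerDl ltW.
  - by rewrite natr1.
  - rewrite natr1 e1 addrAC subrr add0r /h ltr_pdivrMr // ltr_pMr // ltr1n //.
rewrite ge0_fin_numE; last exact: total_variation_ge0.
pose n := Num.truncn ((b - a) / h).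
have [n1 n2] : n%:R <= (b - a) / h /\ (b - a) / h < n.+1%:R.
  by apply/andP; apply: truncn_itv; rewrite divr_ge0 ?subr_ge0 // ltW.
have nb : a + n%:R * h <= b by rewrite -lerBrDl -ler_pdivlMr.
rewrite (@total_variationD _ _ _ (a + n%:R * h)) //; last first.
  by rewrite lerDl mulr_ge0 // ltW.
apply: (@le_lt_trans _ _ (n%:R%:E + 1%:E)%E); last by rewrite -EFinD ltry.
apply: leeD; first exact: main.
apply: short => //; first by rewrite lerDl mulr_ge0 // ltW.
move: n2; rewrite ltr_pdivrMr // -natr1 mulrDl mul1r => n2.
have hd : h < d by rewrite /h ltr_pdivrMr // ltr_pMr // ltr1n.
move: (n%:R * h) n2 => y n2; lra.
Qed.

Lemma fine_total_variationB a b f u v : chain_AC a b f -> a <= u -> u <= v -> v <= b ->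
  fine (TV a v f) - fine (TV a u f) = fine (TV u v f).
Proof.
move=> acf au uv vb.
have ab : a <= b by rewrite (le_trans au) // (le_trans uv).
have fab := chain_AC_total_variation_fin ab acf.
have /(bounded_variationP f ab) bv := fab.
have fu : TV a u f \is a fin_num.
  by apply/bounded_variationP => //; apply: (@bounded_variationl _ _ _ b) => //; apply: le_trans vb.
have fv : TV u v f \is a fin_num.
  apply/bounded_variationP => //; apply: (@bounded_variationr _ a) => //.
  by apply: (@bounded_variationl _ _ _ b) => //; apply: le_trans uv.
by rewrite (total_variationD f au uv) fineD // addrAC subrr add0r.
Qed.

(** The variation over each interval of the chain is a supremum, almost attained
    by a partition of that interval. Concatenating these partitions costs at most
    [eta] per interval and does not change the total length. *)
Lemma chain_refine a b f s lo (eta : R) : chain_AC a b f -> a <= lo -> 0 < eta -> chain b lo s ->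
  exists s', [/\ chain b lo s', lengths s' = lengths s &
    oscillation (fun x => fine (TV a x f)) s <= oscillation f s' + eta * (size s)%:R].
Proof.
move=> acf + eta0; elim: s lo => [|[u v] s IH] lo alo /=.
  by move=> lb; exists [::]; split=> //; rewrite /oscillation !big_nil mulr0 addr0.
move=> /and3P[lou uv cs]; have au := le_trans alo lou; have vb := chain_le cs.
have [s' [cs' ls' os']] := IH _ (le_trans au uv) cs.
have ab : a <= b by rewrite (le_trans au) // (le_trans uv).
have fuv : TV u v f \is a fin_num.
  apply/bounded_variationP => //; apply: (@bounded_variationr _ a) => //.
  apply: (@bounded_variationl _ _ _ b) => //; first exact: le_trans uv.
  exact/bounded_variationP/chain_AC_total_variation_fin.
have [_ [_ [l [pl /eqP lv] <-] <-] hl] := ub_ereal_sup_adherent eta0 fuv.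
exists (cells u l ++ s'); split.
- by apply: chain_weaken lou _; apply: chain_cells => //; rewrite lv.
- by rewrite lengths_cat lengths_cells lv ls' /lengths big_cons.
rewrite oscillation_cons oscillation_cat.
rewrite (fine_total_variationB acf) // (oscillation_cells _ v) ger0_norm; last first.
  by rewrite fine_ge0 // total_variation_ge0.
have : fine (TV u v f) - eta <= variation u v f l.
  by rewrite ltW // -lte_fin EFinB fineK.
rewrite -natr1; move: os'; set A := oscillation _ s; set B := oscillation _ s'.
move=> h1 h2; rewrite mulrDr mulr1; move: (eta * _) h1 => w h1; lra.
Qed.

(** The refined chain is as short as the given one, so absolute continuity of [f]
    controls its oscillation. *)
Lemma chain_AC_total_variation a b f : chain_AC a b f ->
  chain_AC a b (fun x => fine (TV a x f)).
Proof.
move=> acf e e0; have e20 : 0 < e / 2 by rewrite divr_gt0.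
have [d d0 H] := acf _ e20; exists d => // s cs ls.
(* shared among the intervals of [s], the refinement loses at most e / 2 *)
pose eta := (e / 2) / (size s).+1%:R.
have eta0 : 0 < eta by rewrite divr_gt0.
have [s' [cs' ls' hs']] := chain_refine acf (lexx a) eta0 cs.
apply: le_lt_trans hs' _; rewrite (splitr e) ltr_leD //.
  by apply: H => //; rewrite ls'.
rewrite /eta mulrAC ler_pdivrMr // ler_pM2l // ler_nat //.
Qed.

End Chains.

(** * Absolutely continuous functions are primitives *)

Section MonotoneAC.
Context {R : realType}.
Implicit Types (a b : R) (x : nat -> R) (P : pred nat).
Notation mu := (@lebesgue_measure R).

Lemma stieltjes_itv_oc (G : cumulative R R) (u v : R) : u <= v ->
  lebesgue_stieltjes_measure G `]u, v]%classic = (G v - G u)%:E.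
Proof.
move=> uv; rewrite /lebesgue_stieltjes_measure /measure_extension /=.
by rewrite measurable_mu_extE //=; [rewrite wlength_itv_bnd|exact: is_ocitv].
Qed.

Definition grid_cells x P N : set R :=
  \big[setU/set0]_(i < N | P i) `]x i, x i.+1]%classic.

Lemma measurable_grid_cells x P N : measurable (grid_cells x P N).
Proof. by apply: bigsetU_measurable => i _; exact: measurable_itv. Qed.

Lemma grid_cellsP x P N y :
  grid_cells x P N y <-> exists i, [/\ (i < N)%N, P i & y \in `]x i, x i.+1]].
Proof.
rewrite /grid_cells big_mkcond /= -(bigcup_mkord N
  (fun i => if P i then `]x i, x i.+1]%classic else set0)).
split=> [[i /= iN]|[i [iN Pi yi]]]; first by case: ifP => // Pi yi; exists i.
by exists i => //=; rewrite Pi.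
Qed.

Lemma stieltjes_grid_cells (G : cumulative R R) x P N :
  {homo x : i j / (i <= j)%N >-> i <= j} ->
  lebesgue_stieltjes_measure G (grid_cells x P N) =
  (\sum_(i < N | P i) (G (x i.+1) - G (x i)))%:E.
Proof.
move=> ndx; rewrite /grid_cells measure_bigsetU_ord.
- by rewrite -sumEFin; apply: eq_bigr => i _; apply: stieltjes_itv_oc; exact: ndx.
- by move=> i; exact: measurable_itv.
have disj (i j : 'I_N) y : y \in `]x i, x i.+1] -> y \in `]x j, x j.+1] ->
    (i < j)%N -> False.
  rewrite !in_itv /= => /andP[_ h2] /andP[h3 _] ij.
  by have := lt_le_trans h3 (le_trans h2 (ndx _ _ ij)); rewrite ltxx.
move=> i j _ _ [y [yi yj]]; apply: val_inj; case: (ltngtP i j) => // ij.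
  by case: (disj i j y).
by case: (disj j i y).
Qed.

Definition grid_chain x P N : seq (R * R) :=
  [seq (x i, x i.+1) | i <- iota 0 N & P i].

Lemma chain_grid_chain b x P N : {homo x : i j / (i <= j)%N >-> i <= j} ->
  x N <= b -> chain b (x 0%N) (grid_chain x P N).
Proof.
move=> ndx; rewrite /grid_chain -{1}[N]add0n.
elim: N 0%N => [|N IH] m /=; first by rewrite addn0.
rewrite addnS -addSn => /IH; case: ifP => _ /=; last exact/chain_weaken/ndx.
by rewrite lexx ndx.
Qed.

Lemma oscillation_grid_chain (f : R -> R) x P N :
  oscillation f (grid_chain x P N) = \sum_(i < N | P i) `|f (x i.+1) - f (x i)|.
Proof.
rewrite /oscillation /grid_chain big_map big_filter /=.
by rewrite -(big_mkord P (fun i => `|f (x i.+1) - f (x i)|)) /index_iota subn0.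
Qed.

Lemma lengths_grid_chain x P N :
  lengths (grid_chain x P N) = \sum_(i < N | P i) (x i.+1 - x i).
Proof.
rewrite /lengths /grid_chain big_map big_filter /=.
by rewrite -(big_mkord P (fun i => x i.+1 - x i)) /index_iota subn0.
Qed.

(** Cover the null set by an open set U of small Lebesgue measure. The cells of
    the uniform grid with n + 1 steps that lie inside U form a chain of small total
    length, so their Stieltjes measure is at most e. Every point of U in ]a, b] lies
    in such a cell for all large n, so the bound passes to the limit. *)
Lemma null_stieltjes (G : cumulative R R) a b (E : set R) : a < b ->
  chain_AC a b G -> measurable E -> mu E = 0%E ->
  lebesgue_stieltjes_measure G (E `&` `]a, b]%classic) = 0%E.
Proof.
move=> ab acG mE E0; set nu := lebesgue_stieltjes_measure G.
apply/eqP; rewrite eq_le measure_ge0 andbT; apply/lee_addgt0Pr => e e0; rewrite add0e.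
have [d d0 H] := acG e e0.
have [U [oU EU Ud]] : exists U : set R, [/\ open U, E `<=` U & (mu U < d%:E)%E].
  have Eoo : (mu E < +oo)%E by rewrite E0 ltry.
  have [U [oU EU UE]] := lebesgue_regularity_outer mE Eoo d0.
  exists U; split => //; apply: le_lt_trans UE.
  have mUE : measurable (U `\` E).
    by apply: measurableD => //; exact: open_measurable.
  have -> : mu U = (mu E + mu (U `\` E))%E.
    rewrite -[in LHS](setDUK EU); apply: measureU => //.
    by rewrite setDE setIA setIAC setICr set0I.
  by rewrite E0 add0e.
pose x n i := a + i%:R * ((b - a) / n.+1%:R).
have step0 n : 0 < (b - a) / n.+1%:R by rewrite divr_gt0 // subr_gt0.
have ndx n : {homo x n : i j / (i <= j)%N >-> i <= j}.
  by move=> i j ij; rewrite /x lerD2l ler_wpM2r ?ler_nat // ltW.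
have xn0 n : x n 0%N = a by rewrite /x mul0r addr0.
have xnN n : x n n.+1 = b by rewrite /x mulrCA divff // mulr1 addrC subrK.
pose P n i := `[< `]x n i, x n i.+1]%classic `<=` U >].
pose W n := grid_cells (x n) (P n) n.+1.
have mW n : measurable (W n) by exact: measurable_grid_cells.
have WU n : W n `<=` U.
  by move=> y /grid_cellsP[i [_ /asboolP + yi]]; apply.
have nuW n : (nu (W n) <= e%:E)%E.
  rewrite /nu stieltjes_grid_cells // lee_fin ltW //.
  apply: le_lt_trans (H (grid_chain (x n) (P n) n.+1) _ _).
  - by rewrite oscillation_grid_chain; apply: ler_sum => i _; exact: ler_norm.
  - by rewrite -(xn0 n); apply: chain_grid_chain; rewrite ?xnN.
  rewrite lengths_grid_chain -lte_fin; apply: le_lt_trans Ud.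
  rewrite -[X in X%:E]/(\sum_(i < n.+1 | P n i) (idfun (x n i.+1) - idfun (x n i))).
  rewrite -(stieltjes_grid_cells idfun) //; apply: le_measure; rewrite ?inE //.
  - exact: mW.
  - exact: (open_measurable oU).
  - exact: WU.
(* W need not increase with n; the points that stay in W from n on do *)
pose V n := \bigcap_(k in [set k | (n <= k)%N]) W k.
have mV n : measurable (V n).
  by apply: bigcap_measurable => //; exists n => /=.
have VW n : V n `<=` W n by move=> y; apply => /=.
have nuV n : (nu (V n) <= e%:E)%E.
  by apply: le_trans (nuW n); apply: le_measure; rewrite ?inE //; [exact: mV|exact: mW].
have cov : E `&` `]a, b]%classic `<=` \bigcup_n V n.
  move=> y [/EU Uy]; rewrite /= in_itv /= => /andP[ay yb].
  have /nbhs_ballP[r /= r0 rU] := open_nbhs_nbhs (conj oU Uy).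
  pose n := Num.truncn ((b - a) / r).
  exists n => // k /= nk; apply/grid_cellsP.
  have hk : (b - a) / k.+1%:R < r.
    rewrite ltr_pdivrMr // -ltr_pdivrMl // mulrC.
    have /andP[_ h] : n%:R <= (b - a) / r < n.+1%:R.
      by apply: truncn_itv; rewrite divr_ge0 ?subr_ge0 // ltW.
    by apply: lt_le_trans h _; rewrite ler_nat.
  have ex : exists j, y <= x k j by exists k.+1; rewrite xnN.
  case: (ex_minnP ex) => -[|j] yj minj; first by move: yj; rewrite xn0 leNgt ay.
  have jy : x k j < y by rewrite ltNge; apply/negP => /minj; rewrite ltnn.
  exists j; split; [by apply: minj; rewrite xnN| |by rewrite in_itv /= jy yj].
  apply/asboolP => z; rewrite /= in_itv /= => /andP[jz zj]; apply: rU.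
  have xE : x k j.+1 = x k j + (b - a) / k.+1%:R by rewrite /x -natr1; ring.
  move: yj zj jz jy; rewrite xE /ball /= ltr_norml; move: (x k j) ((b - a) / _) hk => w h hk yw zw wz wy.
  by apply/andP; split; lra.
have ndV : {homo V : n m / (n <= m)%N >-> (n <= m)%O}.
  by move=> i j ij; apply/subsetPset => y Vy k /= jk; apply: Vy => /=; exact: leq_trans jk.
have mUV : measurable (\bigcup_n V n) by exact: bigcup_measurable.
apply: (@le_trans _ _ (nu (\bigcup_n V n))).
  by apply: le_measure; rewrite ?inE //; apply: measurableI => //; exact: measurable_itv.
have cv : nu \o V @ \oo --> nu (\bigcup_n V n) by exact: nondecreasing_cvg_mu.
rewrite -(cvg_lim _ cv) //; apply: lime_le; first by apply/cvg_ex; eexists; exact: cv.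
by apply: nearW => n /=; exact: nuV.
Qed.

End MonotoneAC.

Section Primitive.
Context {R : realType}.
Implicit Types (a b : R) (f V : R -> R).
Notation mu := (@lebesgue_measure R).

(** The Stieltjes measure of V is dominated by the Lebesgue measure, and its
    Radon-Nikodym density is the integrand. V is frozen outside [a, b] to obtain a
    nondecreasing function on the whole line. *)
Lemma chain_AC_nondecreasing_primitive a b V : a < b ->
  {in `[a, b] &, nondecreasing_fun V} -> chain_AC a b V ->
  exists2 k : R -> R, mu.-integrable setT (EFin \o k) &
    forall t, t \in `[a, b] -> V t = V a + \int[mu]_(s in `[a, t]) k s.
Proof.
move=> ab ndV acV; pose clamp x := Num.max a (Num.min b x).
have clampI x : clamp x \in `[a, b].
  by rewrite in_itv /= le_max lexx /= ge_max (ltW ab) /= ge_min lexx.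
have clampE x : x \in `[a, b] -> clamp x = x.
  by rewrite in_itv /= => /andP[ax xb]; rewrite /clamp (min_idPr xb) (max_idPr ax).
have ndclamp x y : x <= y -> clamp x <= clamp y.
  by move=> xy; rewrite /clamp ge_max !le_max lexx /= le_min !ge_min lexx xy !orbT.
have clampL x y : x <= y -> clamp y - clamp x <= y - x.
  move=> xy; rewrite /clamp /Num.max /Num.min.
  case: (ltP b x) => bx; case: (ltP b y) => b_y; case: ltP => h1; case: ltP => h2; lra.
have ndG : nondecreasing (V \o clamp).
  by move=> x y xy /=; apply: ndV; rewrite ?clampI // ndclamp.
have rcG : right_continuous (V \o clamp).
  move=> x; apply/cvgrPdist_lt => e e0; have [d d0 H] := acV e e0.
  near=> y; have xy : x <= y by near: y; exact: nbhs_right_ge.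
  have := H [:: (clamp x, clamp y)]; rewrite oscillation_cons /oscillation /lengths.
  rewrite !big_cons !big_nil /= !addr0 distrC; apply.
    have := clampI x; have := clampI y; rewrite !in_itv /= => /andP[_ ->] /andP[-> _].
    by rewrite ndclamp.
  apply: le_lt_trans (clampL _ _ xy) _; rewrite ltrBlDl addrC.
  by rewrite addrC; near: y; apply: nbhs_right_lt; rewrite ltrDl.
pose G : cumulative R R := HB.pack (V \o clamp)
  (isCumulative.Build R _ R (V \o clamp) ndG rcG).
have acG : chain_AC a b G.
  move=> e /acV[d d0 H]; exists d => // s cs /(H _ cs).
  congr (_ < _); rewrite /oscillation; apply: eq_big_seq => p ps.
  have := chain_nth cs (i := index p s); rewrite index_mem nth_index // => /(_ ps)[h1 h2 h3].
  by rewrite /= !clampE // in_itv /= ?h1 ?h3 ?(le_trans h1 h2) // (le_trans h2 h3).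
(* restricted to ]a, b] the Stieltjes measure is finite *)
pose D : set (measurableTypeR R) := `]a, b]%classic.
have mD : measurable D by exact: measurable_itv.
pose nuG : {measure set (measurableTypeR R) -> \bar R} := lebesgue_stieltjes_measure G.
have nuD : (nuG D < +oo)%E.
  by rewrite /nuG /= stieltjes_itv_oc ?ltry // ltW.
pose nu : {finite_measure set (measurableTypeR R) -> \bar R} := mfrestr mD nuD.
have ac : nu `<< mu.
  apply/null_content_dominatesP => A mA A0.
  by rewrite /nu /= /mfrestr /mrestr; exact: null_stieltjes.
have [g [g0 gfin gint gE]] := radon_nikodym_sigma_finite ac.
have gk x : g x = (fine (g x))%:E by rewrite fineK.
exists (fine \o g).
  by move: gint; congr (mu.-integrable _ _); apply/funext => x /=; rewrite -gk.
move=> t; rewrite in_itv /= => /andP[at_ tb].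
have := gE _ (measurable_itv `]a, t]).
have -> : nu `]a, t]%classic = (V t - V a)%:E.
  rewrite /nu /= /mfrestr /mrestr /D.
  have -> : `]a, t]%classic `&` `]a, b]%classic = `]a, t]%classic.
    apply/setIidPl => x /=; rewrite !in_itv /= => /andP[-> xt] /=; exact: le_trans tb.
  rewrite /nuG /= stieltjes_itv_oc //= !clampE // in_itv /= ?lexx ?at_ ?tb //.
  by rewrite ltW.
move=> E; rewrite -Rintegral_itv_obnd_cbnd; last first.
  apply: (@integrableS _ _ _ mu setT) => //.
  by move: gint; congr (mu.-integrable _ _); apply/funext => x /=; rewrite -gk.
rewrite /Rintegral /=; under eq_integral do rewrite -gk.
by rewrite -E /= addrC subrK.
Unshelve. all: by end_near. Qed.

(** Jordan decomposition: the total variation of f, and its difference with f, are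
    both nondecreasing and absolutely continuous. *)
Lemma AC_primitive a b f : a < b -> abs_continuous_on a b f ->
  exists2 k : R -> R, mu.-integrable setT (EFin \o k) &
    forall t, t \in `[a, b] -> f t = f a + \int[mu]_(s in `[a, t]) k s.
Proof.
move=> ab /abs_continuous_on_chain acf; pose V x := fine (total_variation a x f).
have acV : chain_AC a b V by exact: chain_AC_total_variation.
have VB u v : a <= u -> u <= v -> v <= b -> V v - V u = fine (total_variation u v f).
  by move=> au uv vb; rewrite (fine_total_variationB acf).
have [] := @chain_AC_nondecreasing_primitive a b V ab _ acV.
  move=> u v /=; rewrite !in_itv /= => /andP[au ub] /andP[av vb] uv.
  by rewrite -subr_ge0 VB // fine_ge0 // total_variation_ge0.
move=> k1 ik1 E1.
have [] := @chain_AC_nondecreasing_primitive a b (fun x => V x - f x) ab _ (chain_AC_sub acV acf).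
  move=> u v /=; rewrite !in_itv /= => /andP[au ub] /andP[av vb] uv.
  rewrite -subr_ge0; have -> : V v - f v - (V u - f u) = (V v - V u) - (f v - f u) by ring.
  rewrite VB // subr_ge0; apply: le_trans (ler_norm _) _; rewrite -lee_fin fineK.
    exact: total_variation_ge.
  apply/bounded_variationP => //; apply: (@bounded_variationr _ a) => //.
  apply: (@bounded_variationl _ _ _ b) => //.
  apply/bounded_variationP; first exact: ltW.
  by apply: chain_AC_total_variation_fin => //; exact: ltW.
move=> k2 ik2 E2.
exists (k1 \- k2); first by move: (integrableB measurableT ik1 ik2).
move=> t tab; rewrite RintegralB //; last 2 first.
- by apply: (@integrableS _ _ _ mu setT).
- by apply: (@integrableS _ _ _ mu setT).
by have := E1 t tab; have := E2 t tab; lra.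
Qed.

End Primitive.

(** * Double integrals over a triangle and an improper fundamental theorem *)

Section TriangleFubini.
Context {R : realType}.
Notation mu := (@lebesgue_measure R).

Lemma measurable_triangle (a t : R) :
  measurable [set z : R * R | [&& a <= z.2, z.2 <= z.1 & z.1 <= t]].
Proof.
have -> : [set z : R * R | [&& a <= z.2, z.2 <= z.1 & z.1 <= t]] =
    [set z : R * R | a <= z.2] `&` ([set z | z.2 <= z.1] `&` [set z | z.1 <= t]).
  by apply/seteqP; split=> [z /and3P[]//|z [? []] ? ?]; apply/and3P.
have m1 (f g : R * R -> R) : measurable_fun setT f -> measurable_fun setT g ->
    measurable [set z | f z <= g z].
  by move=> mf mg; rewrite -[X in measurable X]setTI; exact: measurable_fun_le.
by apply: measurableI; [|apply: measurableI]; apply: m1 => //;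
  first [exact: measurable_fst|exact: measurable_snd|exact: measurable_cst].
Qed.

Lemma mem_cc (lo hi x : R) : (x \in `[lo, hi]%classic) = (lo <= x <= hi).
Proof. by apply/idP/idP; rewrite in_setE /= in_itv. Qed.

(** Both sides integrate k r * K u r over the triangle a <= r <= u <= t; the bound
    on C makes this function integrable for the product measure. The inner integral
    [q u] converges for almost every u only; the default value it takes elsewhere
    is harmless. *)
Lemma triangle_fubini (k : R -> R) (K : R -> R -> R) (C : R -> R) (a t M : R) :
  mu.-integrable setT (EFin \o k) ->
  measurable_fun [set: R * R] (fun z => K z.1 z.2) ->
  (forall u r, a <= r -> r <= u -> u <= t -> 0 <= K u r) ->
  (forall r, a <= r -> r <= t ->
     (\int[mu]_(u in `[r, t]) (K u r)%:E = (C r)%:E)%E) ->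
  (forall r, a <= r -> r <= t -> C r <= M) ->
  let q u := \int[mu]_(r in `[a, u]) (k r * K u r) in
  mu.-integrable `[a, t] (EFin \o q) /\
  \int[mu]_(u in `[a, t]) q u = \int[mu]_(r in `[a, t]) (k r * C r).
Proof.
move=> ik mK K0 KC CM q.
have mk : measurable_fun setT k by apply/measurable_EFinP; case/integrableP: ik.
pose D := [set z : R * R | [&& a <= z.2, z.2 <= z.1 & z.1 <= t]].
pose g z : R := k z.2 * K z.1 z.2.
(* the integrand, extended by 0 outside the triangle *)
pose f : R * R -> \bar R := EFin \o (g \_ D).
have mD : measurable D by exact: measurable_triangle.
have mg : measurable_fun setT g.
  apply: measurable_funM => //.
  by apply: measurableT_comp => //; exact: measurable_snd.
have mf : measurable_fun setT f.
  apply/measurable_EFinP; apply: (measurable_restrictT _ _).1 => //; exact: measurable_funTS.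
have fE u r : f (u, r) =
    if [&& a <= r, r <= u & u <= t] then (k r * K u r)%:E else 0%E.
  rewrite /f /= patchE; have -> : ((u, r) \in D) = [&& a <= r, r <= u & u <= t].
    by apply/idP/idP; rewrite in_setE.
  by case: ifP.
have sec_r (h : R -> R -> \bar R) r : (forall u, h u r = f (u, r)) -> a <= r ->
    (fun u => h u r) = (fun u => (k r * K u r)%:E) \_ `[r, t]%classic.
  move=> hE ar; apply/funext => u; rewrite hE fE ar patchE /=.
  by rewrite mem_cc; case: ifP.
have sec_r0 r : ~~ (a <= r <= t) -> forall u, f (u, r) = 0%E.
  move=> art u; rewrite fE; case: ifPn => // /and3P[h1 h2 h3].
  by rewrite h1 (le_trans h2 h3) in art.
have sec_u u : u <= t ->
    (fun r => f (u, r)) = (fun r => (k r * K u r)%:E) \_ `[a, u]%classic.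
  move=> ut; apply/funext => r; rewrite fE ut andbT patchE /=.
  by rewrite mem_cc; case: ifP.
have iK r : a <= r -> r <= t -> mu.-integrable `[r, t] (fun u => (K u r)%:E).
  move=> ar rt; apply/integrableP; split.
    apply/measurable_EFinP; apply: measurable_funTS.
    by apply: (measurableT_comp mK (measurable_pair2 r)).
  apply: le_lt_trans (ltry (C r)); rewrite -KC // le_eqVlt; apply/orP; left; apply/eqP.
  apply: eq_integral => u; rewrite in_setE /= in_itv /= => /andP[ru ut].
  by rewrite ger0_norm // K0.
have int_u r : a <= r -> r <= t -> (\int[mu]_u f (u, r) = (k r * C r)%:E)%E.
  move=> ar rt; rewrite (sec_r (fun u r => f (u, r))) // -integral_mkcond.
  under eq_integral do rewrite EFinM.
  by rewrite integralZl ?KC // -?EFinM //; exact: iK.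
have aint_u r : a <= r -> r <= t -> (\int[mu]_u `|f (u, r)| = (`|k r| * C r)%:E)%E.
  move=> ar rt; transitivity (\int[mu]_u (((fun u => (`|k r| * K u r)%:E) \_ `[r, t]%classic) u))%E.
    apply: eq_integral => u _; rewrite fE ar patchE /= mem_cc.
    case: ifP => [/andP[ru ut]|_]; last by rewrite abse0.
    by rewrite /= normrM (ger0_norm (K0 _ _ _ _ _)).
  rewrite -integral_mkcond; under eq_integral do rewrite EFinM.
  by rewrite integralZl ?KC // -?EFinM //; exact: iK.
have C0 r : a <= r -> r <= t -> 0 <= C r.
  move=> ar rt; rewrite -lee_fin -KC //; apply: integral_ge0 => u /=.
  by rewrite in_itv /= => /andP[ru ut]; rewrite lee_fin K0.
have iff : (mu \x mu)%E.-integrable setT f.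
  apply/integrable21ltyP => //.
  apply: (@le_lt_trans _ _ (\int[mu]_r (`|M|%:E * `|(k r)%:E|))%E); last first.
    rewrite integralZl //; last exact: integrable_abse.
    by apply: lte_mul_pinfty => //; case/integrableP: ik.
  apply: ge0_le_integral => //.
  - by move=> r _; exact: integral_ge0.
  - have maf : measurable_fun setT (abse \o f) by exact: measurableT_comp.
    apply: (@measurable_fun_fubini_tonelli_G _ _ _ _ R mu (abse \o f) maf) => z.
    exact: abse_ge0.
  - by apply: measurable_funeM; apply/measurable_EFinP; exact: measurableT_comp.
  move=> r _; have [/andP[ar rt]|art] := boolP (a <= r <= t); last first.
    rewrite integral0_eq ?mule_ge0 // => u _.
    by rewrite sec_r0 // abse0.
  rewrite aint_u // lee_fin mulrC ler_wpM2r // (le_trans (CM _ _ _)) //.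
  exact: ler_norm.
have FE u : a <= u -> u <= t -> fubini_F mu f u = (\int[mu]_(r in `[a, u]) (k r * K u r)%:E)%E.
  by move=> au ut; rewrite /fubini_F sec_u // -integral_mkcond.
have iF := integrable_fubini_F iff.
have mq : measurable_fun `[a, t]%classic q.
  apply: (eq_measurable_fun (fine \o fubini_F mu f)) => [u|].
    by rewrite in_setE /= in_itv /= => /andP[au ut]; rewrite FE.
  apply: measurable_funTS; apply: measurableT_comp => //.
  by case/integrableP: iF.
split.
  have iFt : mu.-integrable `[a, t] (fubini_F mu f) by exact: integrableS iF.
  apply: (le_integrable _ _ _ iFt) => //.
  - exact/measurable_EFinP.
  - move=> u /=; rewrite in_itv /= => /andP[au ut]; rewrite FE // /q /Rintegral.
    by case: (integral _ _ _) => [x||] /=; rewrite ?lexx ?leey.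
have F0 u : ~~ (a <= u <= t) -> fubini_F mu f u = 0%E.
  move=> aut; rewrite /fubini_F integral0_eq // => r _; rewrite fE; case: ifPn => //.
  by move=> /and3P[h1 h2 h3]; rewrite h3 (le_trans h1 h2) in aut.
transitivity (fine (\int[mu]_(u in `[a, t]) fubini_F mu f u)%E).
  rewrite /Rintegral; congr fine; apply: ae_eq_integral => //.
  - by apply/measurable_EFinP.
  - by apply: measurable_funTS; case/integrableP: iF.
  - have := integrable_ae measurableT iF; apply: filterS => u /= /(_ I) ufin.
    rewrite in_itv /= => /andP[au ut]; rewrite [RHS](FE u au ut).
    by rewrite /q /Rintegral fineK // -FE.
transitivity (fine (\int[mu]_u fubini_F mu f u)).
  congr fine.
  rewrite integral_mkcond; apply: eq_integral => u _; rewrite patchE mem_cc.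
  by case: ifPn => // /F0 ->.
rewrite /Rintegral; congr fine.
transitivity (\int[mu]_r fubini_G mu f r)%E.
  by rewrite [LHS](integral12_prod_meas1 iff) -(integral21_prod_meas1 iff).
rewrite [RHS]integral_mkcond; apply: eq_integral => r _; rewrite patchE /fubini_G.
rewrite mem_cc; case: ifPn => [/andP[ar rt]|art]; first exact: int_u.
by rewrite integral0_eq // => u _; exact: sec_r0.
Qed.

End TriangleFubini.

Section ImproperFTC.
Context {R : realType}.
Notation mu := (@lebesgue_measure R).

(** The integrand may blow up at both ends. The fundamental theorem applies on
    the compact subintervals, and monotone convergence passes to the limit. *)
Lemma ge0_FTC_oo (f F : R -> R) (r t : R) : r <= t ->
  {in `]r, t[, forall x, 0 <= f x} -> {in `]r, t[, continuous f} ->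
  {within `[r, t], continuous F} -> {in `]r, t[, forall x : R, is_derive x (1 : R) F (f x)} ->
  (\int[mu]_(x in `[r, t]) (f x)%:E = (F t - F r)%:E)%E.
Proof.
rewrite le_eqVlt => /predU1P[<-|rt] f0 cf cF dF.
  by rewrite set_itv1 integral_set1 subrr.
have mf : measurable_fun `]r, t[%classic f.
  apply: open_continuous_measurable_fun; first exact: interval_open.
  by move=> x; rewrite in_setE => /cf.
rewrite integral_itv_bndoo; last exact/measurable_EFinP.
(* the compact intervals [r + e n, t - e n], nonempty thanks to the factor 1 / 3 *)
pose e n : R := (t - r) / 3 * harmonic n.
have d0 : 0 < (t - r) / 3 by rewrite divr_gt0 // subr_gt0.
have e0 n : 0 < e n by rewrite mulr_gt0 // harmonic_gt0.
have e3 n : e n <= (t - r) / 3.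
  by rewrite ger_pMr // invf_le1 // ler1n.
have nde m n : (m <= n)%N -> e n <= e m.
  by move=> mn; rewrite ler_pM2l // lef_pV2 ?posrE // ler_nat ltnS.
have ce : e n @[n --> \oo] --> (0 : R).
  by rewrite -(mulr0 ((t - r) / 3)); apply: cvgMr; exact: cvg_harmonic.
have lt_rt n : r + e n < t - e n by move: (e3 n) (e0 n); lra.
pose I n : set (measurableTypeR R) := `[r + e n, t - e n]%classic.
have IE : `]r, t[%classic = \bigcup_n I n.
  apply/seteqP; split=> [x|x [n _]]; rewrite /I /= !in_itv /=; last first.
    by move=> /andP[h1 h2]; move: (e0 n) => h; apply/andP; split; lra.
  move=> /andP[rx xt]; pose h := Num.min (x - r) (t - x).
  have h0 : 0 < h by rewrite lt_min !subr_gt0 rx.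
  have /cvgrPdist_lt/(_ h h0)[n _ /(_ n (leqnn n)) /= hn] := ce.
  exists n => //=; rewrite in_itv /=; move: hn.
  rewrite sub0r normrN gtr0_norm // lt_min => /andP[h1 h2].
  by apply/andP; split; lra.
have ndI : {homo I : n m / (n <= m)%N >-> (n <= m)%O}.
  move=> n m nm; apply/subsetPset => x; rewrite /I /= !in_itv /= => /andP[h1 h2].
  by move: (nde _ _ nm) => h; apply/andP; split; lra.
have mI n : measurable (I n : set (measurableTypeR R)) by exact: measurable_itv.
have subI n : I n `<=` `]r, t[%classic by rewrite IE => x Ix; exists n.
have inI n x : x \in `[r + e n, t - e n] -> x \in `]r, t[ by move=> xI; exact: (subI n).
have cI : (\int[mu]_(x in I n) (f x)%:E)%E @[n --> \oo] -->
    (\int[mu]_(x in `]r, t[) (f x)%:E)%E.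
  rewrite IE.
  pose m : {measure set (measurableTypeR R) -> \bar R} := @lebesgue_measure R.
  apply: (@ge0_nondecreasing_set_cvg_integral _ _ R I (EFin \o f) m ndI mI).
  - by move=> n; apply/measurable_EFinP; exact: measurable_funS mf.
  - by move=> n x Ix; rewrite lee_fin f0 //; exact: (subI n).
have FI n : (\int[mu]_(x in I n) (f x)%:E = (F (t - e n) - F (r + e n))%:E)%E.
  have dFn x : x \in `[r + e n, t - e n] -> is_derive x (1 : R) F (f x).
    by move=> /inI /dF.
  rewrite EFinB; apply: continuous_FTC2 => //.
  - apply: continuous_in_subspaceT => x; rewrite in_setE => /inI; exact: cf.
  - have cF' x : x \in `[r + e n, t - e n] -> {for x, continuous F}.
      by move=> /dFn[dx _]; exact/differentiable_continuous/derivable1_diffP.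
    split.
    + by move=> x xI; have [] := dFn x (subset_itv_oo_cc xI).
    + by apply: cvg_at_right_filter; apply: cF'; rewrite in_itv /= lexx ltW.
    + by apply: cvg_at_left_filter; apply: cF'; rewrite in_itv /= lexx ltW.
  - by move=> x xI; have [_] := dFn x (subset_itv_oo_cc xI); rewrite derive1E.
have [_ cr cl] := (continuous_within_itvP F rt).1 cF.
have cFI : (\int[mu]_(x in I n) (f x)%:E)%E @[n --> \oo] --> (F t - F r)%:E.
  under eq_fun do rewrite FI.
  apply: cvg_EFin; first by apply: nearW.
  apply: cvgB.
    apply: (cvg_at_leftP F t (F t)).1 => //; split=> [n|].
      by move: (e0 n); lra.
    by rewrite -[X in _ --> X](subr0 t); apply: cvgB => //; exact: cvg_cst.
  apply: (cvg_at_rightP F r (F r)).1 => //; split=> [n|].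
    by move: (e0 n); lra.
  by rewrite -[X in _ --> X](addr0 r); apply: cvgD => //; exact: cvg_cst.
exact: (cvg_unique _ cI cFI).
Qed.

End ImproperFTC.

(** * Powers, changes of time and fractional integrals *)

Section NormPower.
Context {R : realType}.
Implicit Types c x : R.

(** Near a nonzero point x the absolute value is multiplication by the sign of x. *)
Lemma is_derive_normr_powR c x : x != 0 ->
  is_derive x (1 : R) (fun y => `|y| `^ c) (c * `|x| `^ (c - 1) * Num.sg x).
Proof.
move=> x0; have nx0 : 0 < `|x| by rewrite normr_gt0.
apply: (@near_eq_is_derive _ _ _ (fun y => (Num.sg x * y) `^ c)).
  near=> y; congr (_ `^ _); have yx : `|x - y| < `|x|.
    by near: y; apply: cvgr_dist_lt.
  have [x1|x1|x1] := sgrP x; last 1 first.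
  - rewrite mulN1r ltr0_norm //; move: yx; rewrite (ltr0_norm x1) ltr_norml => /andP[]; lra.
  - by rewrite x1 eqxx in x0.
  - rewrite mul1r gtr0_norm //; move: yx; rewrite (gtr0_norm x1) ltr_norml => /andP[]; lra.
have sx : Num.sg x * x = `|x| by rewrite normrEsg.
apply: (@is_derive1_comp _ (fun z => z `^ c) (fun y => Num.sg x * y)).
  by rewrite sx; exact: is_derive1_powR.
by apply: is_derive_eq; rewrite /GRing.scale /=; ring.
Unshelve. all: by end_near. Qed.

(** The absolute value is what makes the statement true at 0: a power of a negative
    number is 1 by convention. *)
Lemma continuous_normr_powR c : 0 < c -> continuous (fun x : R => `|x| `^ c).
Proof.
move=> c0 x; have [->|x0] := eqVneq x 0; last first.
  have [dx _] := is_derive_normr_powR c x0.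
  exact/differentiable_continuous/derivable1_diffP.
apply/cvgrPdist_lt => e e0; rewrite normr0 powR0 ?gt_eqF //.
have /cvgrPdist_lt/(_ e e0)[d /= d0 H] := powR_cvg0 c0.
near=> y; have [->|y0] := eqVneq y 0; first by rewrite normr0 powR0 ?gt_eqF // subrr normr0.
apply: H => /=; last by rewrite normr_gt0.
rewrite sub0r normrN normr_id -[y]subr0 distrC.
by near: y; apply: cvgr_dist_lt.
Unshelve. all: by end_near. Qed.

Lemma continuous_normr_powR_neq0 c x : x != 0 -> {for x, continuous (fun y : R => `|y| `^ c)}.
Proof.
by move=> /(is_derive_normr_powR c)[dx _]; exact/differentiable_continuous/derivable1_diffP.
Qed.

End NormPower.

(** A change of time: H stands for t ^ rho, up to the sign that makes it increase,
    and dH for its derivative. *)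
Record clock {R : realType} (a b : R) (H dH : R -> R) : Prop := Clock {
  clock_measurable : measurable_fun setT H;
  clock_measurable_rate : measurable_fun setT dH;
  clock_continuous : {within `[a, b], continuous H};
  clock_is_derive : {in `]a, b[, forall x : R, is_derive x (1 : R) H (dH x)};
  clock_continuous_rate : {within `[a, b], continuous dH};
  clock_rate_gt0 : {in `[a, b], forall x, 0 < dH x} }.

Section Kernel.
Context {R : realType} (a b : R) (H dH : R -> R) (cH : clock a b H dH).
Notation mu := (@lebesgue_measure R).

Lemma clock_lt x y : a <= x -> x < y -> y <= b -> H x < H y.
Proof.
apply: gtr0_derive1_incr (clock_continuous cH) x y => z zab.
  by have [] := clock_is_derive cH zab.
have [_ e] := clock_is_derive cH zab; rewrite derive1E e.
exact/(clock_rate_gt0 cH)/subset_itv_oo_cc.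
Qed.

Lemma clock_le x y : a <= x -> x <= y -> y <= b -> H x <= H y.
Proof.
by move=> ax; rewrite le_eqVlt => /predU1P[->//|xy] yb; exact/ltW/clock_lt.
Qed.

Lemma subset_cc_within (f : R -> R) u v : a <= u -> v <= b ->
  {within `[a, b], continuous f} -> {within `[u, v], continuous f}.
Proof.
move=> au vb; apply: continuous_subspaceW => x /=; rewrite !in_itv /=.
by move=> /andP[ux xv]; rewrite (le_trans au ux) (le_trans xv vb).
Qed.

(** An antiderivative of the integrand in s is - (H t - H s) ^ g / g. The integral
    is improper at s = t when g < 1. *)
Lemma integral_kernel_right (g r t : R) : 0 < g -> a <= r -> r <= t -> t <= b ->
  (\int[mu]_(s in `[r, t]) ((H t - H s) `^ (g - 1) * dH s)%:E =
   ((H t - H r) `^ g / g)%:E)%E.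
Proof.
move=> g0 ar rt tb.
have sub x : (x \in `]r, t[) -> (x \in `]a, b[) /\ 0 < H t - H x.
  rewrite !in_itv /= => /andP[rx xt]; rewrite (le_lt_trans ar rx) (lt_le_trans xt tb).
  by split=> //; rewrite subr_gt0 clock_lt // ltW // (le_lt_trans ar rx).
have cHx x : x \in `]r, t[ -> {for x, continuous H}.
  move=> /sub[xab _]; have [dx _] := clock_is_derive cH xab.
  exact/differentiable_continuous/derivable1_diffP.
rewrite (@ge0_FTC_oo _ _ (fun s => - (`|H t - H s| `^ g / g)) r t) //.
- congr (_%:E); rewrite subrr normr0 powR0 ?gt_eqF // mul0r oppr0 add0r opprK.
  by rewrite ger0_norm // subr_ge0 clock_le.
- move=> x /sub[xab Hx]; rewrite mulr_ge0 ?powR_ge0 // ltW //.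
  exact/(clock_rate_gt0 cH)/subset_itv_oo_cc.
- move=> x xrt; have [xab Hx] := sub _ xrt; apply: cvgM.
    apply: (@continuous_comp _ _ _ (fun s => H t - H s) (fun z => z `^ (g - 1))).
      by apply: cvgB; [exact: cvg_cst|exact: cHx].
    have [dx _] := is_derive1_powR (g - 1) Hx.
    exact/differentiable_continuous/derivable1_diffP.
  have ab : a < b by move: xab; rewrite in_itv /= => /andP[]; exact: lt_trans.
  exact: (within_continuous_continuous ab (clock_continuous_rate cH) xab).
- have cc : {within `[r, t], continuous (fun s => H t - H s)}.
    have cHrt := subset_cc_within ar tb (clock_continuous cH).
    by move=> x; apply: cvgB; [exact: cvg_cst|exact: cHrt].
  move=> x; apply: cvgN; apply: cvgM; last exact: cvg_cst.
    apply: (@continuous_cvg _ _ _ _ _ _ (fun z : R => `|z| `^ g)); last exact: cc.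
  exact: continuous_normr_powR.
move=> x /sub[xab Hx].
have dHx := clock_is_derive cH xab.
have d1 : is_derive x (1 : R) (fun s => H t - H s) (- dH x).
  by apply: is_derive_eq; rewrite /GRing.scale /=; ring.
have d2 := @is_derive_normr_powR _ g (H t - H x) (lt0r_neq0 Hx).
have d3 := @is_derive1_comp R (fun y => `|y| `^ g) (fun s => H t - H s) x _ _ d2 d1.
have d4 : is_derive x (1 : R) (fun s => `|H t - H s| `^ g * (- g^-1))
    ((- g^-1) *: (g * `|H t - H x| `^ (g - 1) * Num.sg (H t - H x) * - dH x)).
  by apply: is_derive_eq; rewrite /GRing.scale /=; ring.
have -> : (fun s => - (`|H t - H s| `^ g / g)) = (fun s => `|H t - H s| `^ g * (- g^-1)).
  by apply/funext => s; rewrite mulrN.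
apply: is_derive_eq; rewrite gtr0_sg // mulr1 gtr0_norm //=.
by rewrite /GRing.scale /=; field; rewrite gt_eqF.
Qed.

(** An antiderivative of the integrand in u is (H u - H r) ^ g / g. The integral is
    improper at u = r when g < 1. That this value coincides with
    [integral_kernel_right] is what makes fractional integration commute with
    taking primitives. *)
Lemma integral_kernel_left (g r t : R) : 0 < g -> a <= r -> r <= t -> t <= b ->
  (\int[mu]_(u in `[r, t]) ((H u - H r) `^ (g - 1) * dH u)%:E =
   ((H t - H r) `^ g / g)%:E)%E.
Proof.
move=> g0 ar rt tb.
have sub x : (x \in `]r, t[) -> (x \in `]a, b[) /\ 0 < H x - H r.
  rewrite !in_itv /= => /andP[rx xt]; rewrite (le_lt_trans ar rx) (lt_le_trans xt tb).
  by split=> //; rewrite subr_gt0 clock_lt // ltW // (lt_le_trans xt tb).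
have cHx x : x \in `]r, t[ -> {for x, continuous H}.
  move=> /sub[xab _]; have [dx _] := clock_is_derive cH xab.
  exact/differentiable_continuous/derivable1_diffP.
rewrite (@ge0_FTC_oo _ _ (fun s => `|H s - H r| `^ g / g) r t) //.
- congr (_%:E); rewrite subrr normr0 powR0 ?gt_eqF // mul0r subr0.
  by rewrite ger0_norm // subr_ge0 clock_le.
- move=> x /sub[xab Hx]; rewrite mulr_ge0 ?powR_ge0 // ltW //.
  exact/(clock_rate_gt0 cH)/subset_itv_oo_cc.
- move=> x xrt; have [xab Hx] := sub _ xrt; apply: cvgM.
    apply: (@continuous_comp _ _ _ (fun s => H s - H r) (fun z => z `^ (g - 1))).
      by apply: cvgB; [exact: cHx|exact: cvg_cst].
    have [dx _] := is_derive1_powR (g - 1) Hx.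
    exact/differentiable_continuous/derivable1_diffP.
  have ab : a < b by move: xab; rewrite in_itv /= => /andP[]; exact: lt_trans.
  exact: (within_continuous_continuous ab (clock_continuous_rate cH) xab).
- have cc : {within `[r, t], continuous (fun s => H s - H r)}.
    have cHrt := subset_cc_within ar tb (clock_continuous cH).
    by move=> x; apply: cvgB; [exact: cHrt|exact: cvg_cst].
  move=> x; apply: cvgM; last exact: cvg_cst.
  apply: (@continuous_cvg _ _ _ _ _ _ (fun z : R => `|z| `^ g)); last exact: cc.
  exact: continuous_normr_powR.
move=> x /sub[xab Hx].
have dHx := clock_is_derive cH xab.
have d1 : is_derive x (1 : R) (fun s => H s - H r) (dH x).
  by apply: is_derive_eq; rewrite /GRing.scale /=; ring.
have d2 := @is_derive_normr_powR _ g (H x - H r) (lt0r_neq0 Hx).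
have d3 := @is_derive1_comp R (fun y => `|y| `^ g) (fun s => H s - H r) x _ _ d2 d1.
have d4 : is_derive x (1 : R) (fun s => `|H s - H r| `^ g * g^-1)
    (g^-1 *: (g * `|H x - H r| `^ (g - 1) * Num.sg (H x - H r) * dH x)).
  by apply: is_derive_eq; rewrite /GRing.scale /=; ring.
apply: is_derive_eq; rewrite gtr0_sg // mulr1 gtr0_norm //=.
by rewrite /GRing.scale /=; field; rewrite gt_eqF.
Qed.

End Kernel.

Section FractionalIntegral.
Context {R : realType} (a b : R) (H dH : R -> R) (cH : clock a b H dH).
Notation mu := (@lebesgue_measure R).

(** In the time x = H t this is Gamma(g) times the Riemann-Liouville integral of
    order g based at a. *)
Definition fractional_integral (g : R) (phi : R -> R) (t : R) : R :=
  \int[mu]_(s in `[a, t]) ((H t - H s) `^ (g - 1) * (dH s * phi s)).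

(** The rate of change of the fractional integral of a primitive of k, apart from
    the boundary term at a. The factor dH u is kept inside so that the definition
    fits [triangle_fubini]. *)
Definition fractional_density (g : R) (k : R -> R) (u : R) : R :=
  \int[mu]_(r in `[a, u]) (k r * ((H u - H r) `^ (g - 1) * dH u)).

(** Integration by parts without derivatives. Replace phi s by
    phi a + \int_a^s k and exchange the two integrals: k r gets the weight
    (H t - H r) ^ g / g of [integral_kernel_right]. By [integral_kernel_left] this
    weight is also an integral over u in [r, t], and exchanging the integrals again
    exhibits a primitive in t. *)
Lemma fractional_integral_primitive (g t : R) (phi k : R -> R) :
  0 < g -> a <= t -> t <= b -> mu.-integrable setT (EFin \o k) ->
  (forall s, s \in `[a, b] -> phi s = phi a + \int[mu]_(r in `[a, s]) k r) ->
  [/\ mu.-integrable `[a, t]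
        (fun s => ((H t - H s) `^ (g - 1) * (dH s * phi s))%:E),
      mu.-integrable `[a, t] (EFin \o fractional_density g k) &
      fractional_integral g phi t = phi a * ((H t - H a) `^ g / g) +
        \int[mu]_(u in `[a, t]) fractional_density g k u].
Proof.
move=> g0 at_ tb ik phiE.
pose K1 s := (H t - H s) `^ (g - 1) * dH s.
pose K2 u r := (H u - H r) `^ (g - 1) * dH u.
(* the common value of the integrals of both kernels over [r, t] *)
pose C r := (H t - H r) `^ g / g.
have mH := clock_measurable cH; have mdH := clock_measurable_rate cH.
have mK1 : measurable_fun setT K1.
  apply: measurable_funM => //; apply: (measurableT_comp (measurable_powR _)).
  exact: measurable_funB.
have mK2 : measurable_fun setT (fun z : R * R => K2 z.1 z.2).
  apply: measurable_funM; last exact: (measurableT_comp mdH measurable_fst).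
  apply: (measurableT_comp (measurable_powR _)); apply: measurable_funB.
    exact: (measurableT_comp mH measurable_fst).
  exact: (measurableT_comp mH measurable_snd).
have dH0 s : a <= s -> s <= t -> 0 <= dH s.
  move=> as_ st; apply: ltW; apply: (clock_rate_gt0 cH).
  by rewrite in_itv /= as_ (le_trans st tb).
have CM r : a <= r -> r <= t -> C r <= C a.
  move=> ar rt; have rb := le_trans rt tb.
  rewrite ler_pM2r ?invr_gt0 //; apply: ge0_ler_powR; first exact: ltW.
  - by rewrite nnegrE subr_ge0 (clock_le cH).
  - by rewrite nnegrE subr_ge0 (clock_le cH).
  - by rewrite lerD2l lerN2 (clock_le cH).
have [iq1 Eq1] : mu.-integrable `[a, t]
      (EFin \o (fun u => \int[mu]_(r in `[a, u]) (k r * K1 u))) /\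
    \int[mu]_(u in `[a, t]) (\int[mu]_(r in `[a, u]) (k r * K1 u)) =
    \int[mu]_(r in `[a, t]) (k r * C r).
  apply: (@triangle_fubini _ k (fun u _ => K1 u) C a t (C a)) => //.
  - exact: (measurableT_comp mK1 measurable_fst).
  - move=> u r ar ru ut; rewrite mulr_ge0 ?powR_ge0 // dH0 // (le_trans ar ru) //.
  - by move=> r ar rt; exact: (integral_kernel_right cH).
have [iq2 Eq2] : mu.-integrable `[a, t] (EFin \o fractional_density g k) /\
    \int[mu]_(u in `[a, t]) (fractional_density g k u) =
    \int[mu]_(r in `[a, t]) (k r * C r).
  apply: (@triangle_fubini _ k K2 C a t (C a)) => //.
  - move=> u r ar ru ut; rewrite mulr_ge0 ?powR_ge0 // dH0 // (le_trans ar ru) //.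
  - by move=> r ar rt; exact: (integral_kernel_left cH).
have iK1 : mu.-integrable `[a, t] (EFin \o K1).
  apply/integrableP; split; first by apply/measurable_EFinP; exact: measurable_funTS.
  apply: le_lt_trans (ltry (C a)).
  rewrite -(integral_kernel_right cH) // le_eqVlt; apply/orP; left; apply/eqP.
  apply: eq_integral => s; rewrite mem_cc => /andP[as_ st] /=.
  by rewrite ger0_norm // mulr_ge0 ?powR_ge0 // dH0.
have E s : s \in `[a, t]%classic -> (H t - H s) `^ (g - 1) * (dH s * phi s) =
    phi a * K1 s + \int[mu]_(r in `[a, s]) (k r * K1 s).
  rewrite mem_cc => /andP[as_ st].
  rewrite (phiE s) ?in_itv /= ?as_ ?(le_trans st tb) // RintegralZr //; last first.
    exact: integrableS ik.
  by rewrite /K1; ring.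
have iphi : mu.-integrable `[a, t] (EFin \o (fun s => phi a * K1 s)).
  by rewrite (_ : _ \o _ = (fun s => ((phi a)%:E * (K1 s)%:E)%E)) //; exact: integrableZl.
pose F1 s := phi a * K1 s.
pose F2 s := \int[mu]_(r in `[a, s]) (k r * K1 s).
have mI : measurable (`[a, t]%classic : set (measurableTypeR R)) by exact: measurable_itv.
have i12 : mu.-integrable `[a, t] (EFin \o (fun s => F1 s + F2 s)).
  exact: (integrableD mI iphi iq1).
split => //.
  apply: (eq_integrable mI _ _ _ i12) => s sI /=; rewrite E //.
have -> : fractional_integral g phi t = \int[mu]_(s in `[a, t]) (F1 s + F2 s).
  apply: eq_Rintegral => s sI; rewrite E //.
have iF1 : mu.-integrable `[a, t] (EFin \o F1) by exact: iphi.
have EF1 : \int[mu]_(s in `[a, t]) F1 s = phi a * ((H t - H a) `^ g / g).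
  rewrite [LHS](RintegralZl _ mI iK1); apply: (congr1 ( *%R (phi a))).
  by rewrite /Rintegral (integral_kernel_right cH).
rewrite (RintegralD mI iF1 iq1); exact: (congr2 +%R EF1 (etrans Eq1 (esym Eq2))).
Qed.

End FractionalIntegral.

(** * Derivatives relative to an interval *)

Section DerivativeOn.
Context {R : realType} (a b : R).
Implicit Types (f g : R -> R) (t l : R).

(** Relational form of [derivable_on] and [derive_on], suited to computing limits. *)
Definition derivative_on f t l : Prop :=
  (f s - f t) / (s - t) @[s --> within `[a, b] t^'] --> l.

(** Limits along this filter are unique, which identifies [derive_on]. *)
Lemma within_itv_dnbhs_proper t : a < b -> t \in `[a, b] ->
  ProperFilter (within `[a, b]%classic t^').
Proof.
move=> ab; rewrite in_itv /= => /andP[at_ tb]; split; last exact: within_filter.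
move=> /nbhs_ballP[e /= e0 H].
have [s [st sI se]] : exists s, [/\ s != t, s \in `[a, b] & `|t - s| < e].
  have [ta|ta] := ltP a t.
    apply: (@filter_ex _ t^'-); near=> s.
    have st : s < t by near: s; exact: nbhs_left_lt.
    split; first by rewrite lt_eqF.
      rewrite in_itv /= (le_trans (ltW st) tb) andbT.
      by near: s; exact: nbhs_left_ge.
    rewrite gtr0_norm ?subr_gt0 // ltrBlDr -ltrBlDl.
    by near: s; apply: nbhs_left_gt; rewrite ltrBlDr ltrDl.
  have tb' : t < b by rewrite (le_lt_trans ta).
  apply: (@filter_ex _ t^'+); near=> s.
  have st : t < s by near: s; exact: nbhs_right_gt.
  split; first by rewrite gt_eqF.
    rewrite in_itv /= (le_trans at_ (ltW st)) /=.
    by near: s; exact: nbhs_right_le.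
  rewrite distrC gtr0_norm ?subr_gt0 // ltrBlDl.
  by near: s; apply: nbhs_right_lt; rewrite ltrDl.
exact: (H s).
Unshelve. all: by end_near. Qed.

Lemma derivative_onP f t l : a < b -> t \in `[a, b] -> derivative_on f t l ->
  derivable_on a b f t /\ derive_on a b f t = l.
Proof.
move=> ab tab fl; split; first by apply/cvg_ex; exists l.
have := within_itv_dnbhs_proper ab tab => ?.
exact: cvg_lim fl.
Qed.

Lemma derivable_onP f t : derivable_on a b f t -> derivative_on f t (derive_on a b f t).
Proof. by []. Qed.

(** The Caratheodory form of differentiability: the slope g extends continuously
    to t. *)
Lemma derivative_on_caratheodory f g t l : (forall s, f s - f t = g s * (s - t)) ->
  g s @[s --> within `[a, b] t^'] --> l -> derivative_on f t l.
Proof.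
move=> fE; apply: cvg_trans; apply: near_eq_cvg.
rewrite !near_withinE; near=> s => st _.
by rewrite fE mulfK // subr_eq0.
Unshelve. all: by end_near. Qed.

Lemma cvg_within_dnbhs (g : R -> R) t l : g s @[s --> t] --> l ->
  g s @[s --> within `[a, b] t^'] --> l.
Proof.
apply: cvg_trans; apply: cvg_app.
exact: (cvg_trans (cvg_within _) (cvg_within _)).
Qed.

Lemma is_derive_derivative_on f t l : is_derive t (1 : R) f l -> derivative_on f t l.
Proof.
move=> /is_derive1_caratheodory[g [fE cg <-]].
by apply: (derivative_on_caratheodory fE); exact: cvg_within_dnbhs.
Qed.

Lemma derivative_on_ext f g t l : (\forall s \near within `[a, b] (nbhs t), f s = g s) ->
  f t = g t -> derivative_on f t l -> derivative_on g t l.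
Proof.
move=> fg fgt; apply: cvg_trans; apply: near_eq_cvg.
move: fg; rewrite !near_withinE => fg; near=> s => st sI.
rewrite fgt; congr ((_ - _) / _).
by move: sI; near: s.
Unshelve. all: by end_near. Qed.

Lemma derivative_on_continuous f t l : derivative_on f t l ->
  f s @[s --> within `[a, b] (nbhs t)] --> f t.
Proof.
move=> fl.
have h : (f s - f t) / (s - t) * (s - t) + f t @[s --> within `[a, b] t^'] --> l * (t - t) + f t.
  apply: cvgD; last exact: cvg_cst; apply: cvgM => //.
  by apply: cvg_within_dnbhs; apply: cvgB; [exact: cvg_id|exact: cvg_cst].
rewrite subrr mulr0 add0r in h.
apply/cvgrPdist_lt => e e0; move/cvgrPdist_lt: h => /(_ e e0).
rewrite !near_withinE => h; near=> s => sI.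
have [->|st] := eqVneq s t; first by rewrite subrr normr0.
have := st; rewrite -subr_eq0 => st0.
have -> : f s = (f s - f t) / (s - t) * (s - t) + f t by rewrite divfK // subrK.
by move: st sI; near: s.
Unshelve. all: by end_near. Qed.

Lemma nbhs_itv_oo t : t \in `]a, b[ -> nbhs t `[a, b]%classic.
Proof.
move=> tab; have : nbhs t `]a, b[%classic.
  by apply: open_nbhs_nbhs; split => //; exact: interval_open.
by apply: filterS => s; exact: subset_itv_oo_cc.
Qed.

Lemma derivative_on_is_derive f t l : t \in `]a, b[ -> derivative_on f t l ->
  is_derive t (1 : R) f l.
Proof.
move=> tab fl; apply/is_derive1_caratheodory.
exists (fun s => if s == t then l else (f s - f t) / (s - t)); split; last by rewrite eqxx.
- move=> s; case: eqVneq => [->|st]; first by rewrite !subrr mulr0.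
  by rewrite divfK // subr_eq0.
apply/cvgrPdist_lt => e e0; rewrite eqxx; move/cvgrPdist_lt: fl => /(_ e e0).
rewrite !near_withinE => h; near=> s.
have [st|st] := eqVneq s t; first by rewrite subrr normr0.
have sI : `[a, b]%classic s by near: s; exact: nbhs_itv_oo.
by move: st sI; near: s.
Unshelve. all: by end_near. Qed.

Lemma derivative_onD f g t l l' : derivative_on f t l -> derivative_on g t l' ->
  derivative_on (fun s => f s + g s) t (l + l').
Proof.
move=> fl gl; apply: cvg_trans (cvgD fl gl); apply: near_eq_cvg.
by apply: nearW => s /=; rewrite !fctE -mulrDl opprD addrACA.
Qed.

Lemma derivative_onM f g t l l' : derivative_on f t l -> derivative_on g t l' ->
  derivative_on (fun s => f s * g s) t (l * g t + f t * l').
Proof.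
move=> fl gl.
have gt : g s @[s --> within `[a, b] t^'] --> g t.
  apply: cvg_trans (derivative_on_continuous gl); apply: cvg_app => P.
  by rewrite /within /=; apply: (@filterS _ (nbhs t) _) => s h _.
have ct : (fun=> f t) s @[s --> within `[a, b] t^'] --> f t by exact: cvg_cst.
have h := cvgD (cvgM fl gt) (cvgM ct gl).
apply: cvg_trans (h _ _ _); apply: near_eq_cvg.
apply: nearW => s.
change ((f s - f t) / (s - t) * g s + f t * ((g s - g t) / (s - t)) =
  (f s * g s - f t * g t) / (s - t)).
by move: (s - t)^-1 => w; ring.
Qed.

Lemma derivative_onZ f t l c : derivative_on f t l -> derivative_on (fun s => c * f s) t (c * l).
Proof.
move=> fl; 
have ct : (fun=> c) s @[s --> within `[a, b] t^'] --> c by exact: cvg_cst.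
have h := cvgM ct fl; apply: cvg_trans (h _); apply: near_eq_cvg.
by apply: nearW => s /=; rewrite mulrA -mulrBr.
Qed.

End DerivativeOn.

(** * Functions with an absolutely continuous derivative of order n *)

Section SmoothAC.
Context {R : realType} (a b : R) (ab : a < b).
Implicit Types (f g : R -> R) (c M : R).
Notation mu := (@lebesgue_measure R).

(** [smooth_AC n] is [ACm n.+1] with the successive derivatives given existentially
    and required inside the interval only: no choice of values of [derive_on] has to
    be followed through sums and products. *)
Fixpoint smooth_AC n f : Prop :=
  if n is k.+1 then
    {within `[a, b], continuous f} /\
    exists2 f', smooth_AC k f' & {in `]a, b[, forall x : R, is_derive x (1 : R) f (f' x)}
  else abs_continuous_on a b f.

Lemma abs_continuous_on_ext f g : {in `[a, b], f =1 g} ->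
  abs_continuous_on a b f -> abs_continuous_on a b g.
Proof.
move=> fg acf e e0; have [d d0 H] := acf e e0; exists d => // n u v uv tr /(H _ _ _ uv tr).
congr (_ < _); apply: eq_bigr => i _; have [h1 h2 h3] := uv i.
rewrite !fg // in_itv /= ?h3 ?h1 ?andbT; first exact: le_trans h3.
exact: (le_trans h1).
Qed.

(** Apply the definition to the single interval between x and y. *)
Lemma abs_continuous_on_continuous f : abs_continuous_on a b f ->
  {within `[a, b], continuous f}.
Proof.
move=> acf; apply/subspace_continuousP => x /= xab; apply/cvgrPdist_lt => e e0.
have [d d0 H] := acf e e0; rewrite near_withinE; near=> y => yab.
have xy : `|x - y| < d by near: y; apply: cvgr_dist_lt.
move: xab yab; rewrite /= !in_itv /= => /andP[ax xb] /andP[ay yb].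
have {H} := H 1%N (fun=> Num.min x y) (fun=> Num.max x y).
rewrite !big_ord1 => H.
have {H} : `|f (Num.max x y) - f (Num.min x y)| < e.
  apply: H.
  - by move=> _; rewrite le_min ax ay le_max !ge_min !ge_max xb yb lexx.
  - by move=> i j _ _ _; rewrite !ord1.
  - rewrite (le_lt_trans _ xy) // maxEle minEle; case: (leP x y) => h.
      by rewrite distrC ler_norm.
    by rewrite ler_norm.
rewrite maxEle minEle; case: (leP x y) => _ //; by rewrite distrC.
Unshelve. all: by end_near. Qed.

Lemma continuous_bounded f : {within `[a, b], continuous f} ->
  exists2 M, 0 < M & {in `[a, b], forall x, `|f x| <= M}.
Proof.
move=> cf; have cnf : {within `[a, b], continuous (fun x => `|f x|)}.
  by move=> x; apply: (@continuous_cvg _ _ _ _ _ _ (fun z : R => `|z|)); [exact: norm_continuous|exact: cf].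
have [c _ cM] := EVT_max (ltW ab) cnf; exists (`|f c| + 1); first by rewrite ltr_wpDl.
by move=> x /cM; move=> h; rewrite (le_trans h) // lerDl.
Qed.

Lemma lipschitz_abs_continuous_on f M : 0 < M ->
  (forall x y, a <= x -> x <= y -> y <= b -> `|f y - f x| <= M * (y - x)) ->
  abs_continuous_on a b f.
Proof.
move=> M0 lf e e0; exists (e / M); first by rewrite divr_gt0.
move=> n u v uv _; rewrite ltr_pdivlMr // mulrC mulr_sumr; apply: le_lt_trans.
by apply: ler_sum => i _; have [h1 h2 h3] := uv i; exact: lf.
Qed.

Lemma abs_continuous_onD f g : abs_continuous_on a b f -> abs_continuous_on a b g ->
  abs_continuous_on a b (fun x => f x + g x).
Proof.
move=> acf acg e e0; have e20 : 0 < e / 2 by rewrite divr_gt0.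
have [d1 d10 H1] := acf _ e20; have [d2 d20 H2] := acg _ e20.
exists (Num.min d1 d2); first by rewrite lt_min d10.
move=> n u v uv tr; rewrite lt_min => /andP[/(H1 _ _ _ uv tr) l1 /(H2 _ _ _ uv tr) l2].
rewrite (splitr e); apply: le_lt_trans (ltrD l1 l2).
rewrite -big_split /=; apply: ler_sum => i _.
by rewrite opprD addrACA; exact: ler_normD.
Qed.

Lemma abs_continuous_onM f g : abs_continuous_on a b f -> abs_continuous_on a b g ->
  abs_continuous_on a b (fun x => f x * g x).
Proof.
move=> acf acg.
have [M M0 fM] := continuous_bounded (abs_continuous_on_continuous acf).
have [N N0 gN] := continuous_bounded (abs_continuous_on_continuous acg).
move=> e e0.
have eN0 : 0 < e / 2 / N by rewrite !divr_gt0.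
have eM0 : 0 < e / 2 / M by rewrite !divr_gt0.
have [d1 d10 H1] := acf _ eN0; have [d2 d20 H2] := acg _ eM0.
exists (Num.min d1 d2); first by rewrite lt_min d10.
move=> n u v uv tr; rewrite lt_min => /andP[/(H1 _ _ _ uv tr) l1 /(H2 _ _ _ uv tr) l2].
rewrite ltr_pdivlMr // in l1; rewrite ltr_pdivlMr // in l2; rewrite (splitr e).
apply: le_lt_trans (ltrD l1 l2); rewrite !mulr_suml -big_split /=.
apply: ler_sum => i _; have [h1 h2 h3] := uv i.
have uI : u i \in `[a, b] by rewrite in_itv /= h1 (le_trans h2 h3).
have vI : v i \in `[a, b] by rewrite in_itv /= h3 (le_trans h1 h2).
have -> : f (v i) * g (v i) - f (u i) * g (u i) =
   (f (v i) - f (u i)) * g (v i) + (g (v i) - g (u i)) * f (u i) by ring.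
apply: le_trans (ler_normD _ _) _; rewrite !normrM.
by apply: lerD; apply: ler_wpM2l => //; [exact: gN|exact: fM].
Qed.

Lemma smooth_AC_continuous n f : smooth_AC n f -> {within `[a, b], continuous f}.
Proof. by case: n => [|n] /=; [exact: abs_continuous_on_continuous|case]. Qed.

Lemma continuous_within_ext f g : {in `[a, b], f =1 g} ->
  {within `[a, b], continuous f} -> {within `[a, b], continuous g}.
Proof.
move=> fg cf; apply/subspace_continuousP => x /= xab.
have h : f y @[y --> within `[a, b] (nbhs x)] --> g x.
  by rewrite -(fg _ xab); move/subspace_continuousP : cf; exact.
apply: cvg_trans h; apply: near_eq_cvg; rewrite near_withinE.
by apply: nearW => y yab; first [exact: fg|exact: (esym (fg _ _))].
Qed.

Lemma smooth_AC_ext n f g : {in `[a, b], f =1 g} -> smooth_AC n f -> smooth_AC n g.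
Proof.
case: n => [|n] fg /=; first exact: abs_continuous_on_ext.
move=> [cf [f' sf' df]]; split.
  exact: continuous_within_ext cf.
exists f' => // x xab; have := df x xab; apply: near_eq_is_derive.
have := nbhs_itv_oo xab; apply: filterS => y yab; exact: fg.
Qed.

(** By the mean value theorem such a function is Lipschitz. *)
Lemma C1_abs_continuous_on f f' : {within `[a, b], continuous f} ->
  {within `[a, b], continuous f'} ->
  {in `]a, b[, forall x : R, is_derive x (1 : R) f (f' x)} -> abs_continuous_on a b f.
Proof.
move=> cf cf' df; have [M M0 fM] := continuous_bounded cf'.
apply: (lipschitz_abs_continuous_on M0) => x y ax; rewrite le_eqVlt => /predU1P[->|xy] yb.
  by rewrite !subrr normr0 mulr0.
have sub z : z \in `]x, y[ -> z \in `]a, b[.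
  by rewrite !in_itv /= => /andP[xz zy]; rewrite (le_lt_trans ax xz) (lt_le_trans zy yb).
have [||z zxy ->] := @MVT _ f f' x y xy.
- by move=> z /sub/df.
- apply: continuous_subspaceW cf => z /=; rewrite !in_itv /=.
  by move=> /andP[xz zy]; rewrite (le_trans ax xz) (le_trans zy yb).
rewrite normrM (ger0_norm (x := y - x)) ?subr_ge0 ?(ltW xy) // ler_pM2r ?subr_gt0 //.
by apply/fM/subset_itv_oo_cc/sub.
Qed.

Lemma smooth_ACW n f : smooth_AC n.+1 f -> smooth_AC n f.
Proof.
elim: n f => [|n IH] f [cf [f' sf' df]].
  exact: C1_abs_continuous_on cf (abs_continuous_on_continuous sf') df.
by split=> //; exists f' => //; exact: IH.
Qed.

Lemma smooth_ACD n f g : smooth_AC n f -> smooth_AC n g ->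
  smooth_AC n (fun x => f x + g x).
Proof.
elim: n f g => [|n IH] f g /=; first exact: abs_continuous_onD.
move=> [cf [f' sf' df]] [cg [g' sg' dg]]; split.
  by move=> x; apply: cvgD; [exact: cf|exact: cg].
exists (fun x => f' x + g' x); first exact: IH.
move=> x xab; have d1 := df x xab; have d2 := dg x xab.
exact: is_deriveD.
Qed.

Lemma smooth_ACM n f g : smooth_AC n f -> smooth_AC n g ->
  smooth_AC n (fun x => f x * g x).
Proof.
elim: n f g => [|n IH] f g; first exact: abs_continuous_onM.
move=> sf sg; have sf0 := smooth_ACW sf; have sg0 := smooth_ACW sg.
case: sf => cf [f' sf' df]; case: sg => cg [g' sg' dg]; split.
  by move=> x; apply: cvgM; [exact: cf|exact: cg].
exists (fun x => f x * g' x + f' x * g x).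
  by apply: smooth_ACD; exact: IH.
move=> x xab; have d1 := df x xab; have d2 := dg x xab.
by apply: is_derive_eq; rewrite /GRing.scale /=; ring.
Qed.

Lemma smooth_AC_cst n c : smooth_AC n (fun=> c).
Proof.
elim: n c => [|n IH] c /=.
  apply: (lipschitz_abs_continuous_on (M := 1)) => // x y ax xy yb.
  by rewrite subrr normr0 mul1r subr_ge0.
split; first by move=> x; exact: cvg_cst.
by exists (fun=> 0) => // x _; exact: is_derive_cst.
Qed.

Lemma smooth_AC_primitive n f : smooth_AC n f ->
  exists2 k : R -> R, mu.-integrable setT (EFin \o k) &
    forall t, t \in `[a, b] -> f t = f a + \int[mu]_(s in `[a, t]) k s.
Proof. by move=> sf; apply: AC_primitive => //; elim: n sf => // n IH /smooth_ACW. Qed.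

Lemma ACm_smooth_AC m f : ACm m.+1 a b f -> smooth_AC m f.
Proof.
move=> [] /=; elim: m f => [|m IH] f dF ac //=.
have df0 t : t \in `[a, b] -> derivative_on a b f t (derive_on a b f t).
  by move=> tab; apply: derivable_onP; exact: (dF 0%N).
split.
  by apply/subspace_continuousP => x xab; exact: (derivative_on_continuous (df0 x xab)).
exists (derive_on a b f).
  apply: IH; last by rewrite -iterSr.
  by move=> k t km tab; rewrite -iterSr; exact: dF.
move=> x xab; apply: (derivative_on_is_derive xab); apply: df0.
exact: subset_itv_oo_cc.
Qed.

(** The sign of x is constant on an interval that avoids 0. *)
Lemma smooth_AC_normr_powR n c : 0 \notin `[a, b] -> smooth_AC n (fun x => `|x| `^ c).
Proof.
move=> ab0.
have x0 x : x \in `[a, b] -> x != 0 by move=> xab; apply: contraNneq ab0 => <-.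
have [e sgE] : exists e : R, {in `[a, b], forall x, Num.sg x = e}.
  have [a0|a0] := ltP 0 a.
    exists 1 => x; rewrite in_itv /= => /andP[ax _]; rewrite gtr0_sg //; exact: lt_le_trans ax.
  exists (-1) => x; rewrite in_itv /= => /andP[_ xb]; rewrite ltr0_sg //.
  apply: le_lt_trans xb _; rewrite ltNge; apply/negP => b0.
  by rewrite in_itv /= a0 b0 in ab0.
have cc d : {within `[a, b], continuous (fun x => `|x| `^ d)}.
  by apply: continuous_in_subspaceT => x; rewrite in_setE => /x0; exact: continuous_normr_powR_neq0.
have dd d x : x \in `]a, b[ ->
    is_derive x (1 : R) (fun y => `|y| `^ d) (d * e * `|x| `^ (d - 1)).
  move=> xab; have xI := subset_itv_oo_cc xab.
  by have := is_derive_normr_powR d (x0 x xI); rewrite (sgE x xI) mulrAC.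
elim: n c => [|n IH] c.
  apply: C1_abs_continuous_on (cc c) _ (dd c).
  by move=> x; apply: cvgM; [exact: cvg_cst|exact: cc].
split=> //; exists (fun x => c * e * `|x| `^ (c - 1)); last exact: dd.
by apply: smooth_ACM => //; exact: smooth_AC_cst.
Qed.

End SmoothAC.

(** * Iterated weighted derivatives *)

Section IteratedDerivability.
Context {R : realType} (a b : R) (ab : a < b) (w : R -> R).
Implicit Types (f g : R -> R).
Notation mu := (@lebesgue_measure R).

Definition weighted_derivative f t := w t * derive_on a b f t.

(** n + 1 applications of the operator are possible: the first n at every interior
    point, the last one almost everywhere. *)
Fixpoint iter_derivable n f : Prop :=
  if n is k.+1 then {in `]a, b[, forall t, derivable_on a b f t} /\
                    iter_derivable k (weighted_derivative f)
  else {ae mu, forall t, t \in `]a, b[ -> derivable_on a b f t}.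

Lemma is_derive_derivable_on f t l : t \in `]a, b[ -> is_derive t (1 : R) f l ->
  derivable_on a b f t /\ derive_on a b f t = l.
Proof.
move=> tab df; apply: derivative_onP => //; first exact: subset_itv_oo_cc.
exact: is_derive_derivative_on.
Qed.

Lemma derivable_on_oo_ext f g t : {in `]a, b[, f =1 g} -> t \in `]a, b[ ->
  derivable_on a b f t -> derivable_on a b g t /\ derive_on a b g t = derive_on a b f t.
Proof.
move=> fg tab /derivable_onP df; apply: derivative_onP => //; first exact: subset_itv_oo_cc.
apply: derivative_on_ext df; last exact: fg.
rewrite near_withinE; have : nbhs t `]a, b[%classic.
  by apply: open_nbhs_nbhs; split => //; exact: interval_open.
by apply: filterS => s sab _; exact: fg.
Qed.

Lemma iter_derivable_ext n f g : {in `]a, b[, f =1 g} ->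
  iter_derivable n f -> iter_derivable n g.
Proof.
elim: n f g => [|n IH] f g fg /=.
  by apply: (@filterS _ _ (ae_filter_ringOfSetsType mu)) => t ht tab; have [] := derivable_on_oo_ext fg tab (ht tab).
move=> [df nf]; split.
  by move=> t tab; have [] := derivable_on_oo_ext fg tab (df t tab).
apply: IH nf => t tab; rewrite /weighted_derivative.
by have [_ ->] := derivable_on_oo_ext fg tab (df t tab).
Qed.

Lemma iter_derivableS n f f' : {in `]a, b[, forall x : R, is_derive x (1 : R) f (f' x)} ->
  iter_derivable n (fun t => w t * f' t) -> iter_derivable n.+1 f.
Proof.
move=> df nf; split.
  by move=> t tab; have [] := is_derive_derivable_on tab (df t tab).
apply: iter_derivable_ext nf => t tab; rewrite /weighted_derivative.
by have [_ ->] := is_derive_derivable_on tab (df t tab).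
Qed.

Lemma iter_derivable0 f f' : {in `]a, b[, forall x : R, is_derive x (1 : R) f (f' x)} ->
  iter_derivable 0 f.
Proof. by move=> df; apply: aeW => t tab; have [] := is_derive_derivable_on tab (df t tab). Qed.

Lemma iter_derivableD n f g : iter_derivable n f -> iter_derivable n g ->
  iter_derivable n (fun t => f t + g t).
Proof.
elim: n f g => [|n IH] f g /=.
  apply: (@filterS2 _ _ (ae_filter_ringOfSetsType mu)) => t hf hg tab.
  have /derivable_onP df := hf tab; have /derivable_onP dg := hg tab.
  by have [] := derivative_onP ab (subset_itv_oo_cc tab) (derivative_onD df dg).
move=> [df nf] [dg ng].
have h t (tab : t \in `]a, b[) := derivative_onP ab (subset_itv_oo_cc tab)
  (derivative_onD (derivable_onP (df t tab)) (derivable_onP (dg t tab))).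
split; first by move=> t tab; have [] := h t tab.
apply: iter_derivable_ext (IH _ _ nf ng) => t tab; rewrite /weighted_derivative.
by have [_ ->] := h t tab; rewrite mulrDr.
Qed.

Lemma iter_derivableZ n c f : iter_derivable n f -> iter_derivable n (fun t => c * f t).
Proof.
elim: n f => [|n IH] f /=.
  apply: (@filterS _ _ (ae_filter_ringOfSetsType mu)) => t hf tab; have /derivable_onP df := hf tab.
  by have [] := derivative_onP ab (subset_itv_oo_cc tab) (derivative_onZ (c := c) df).
move=> [df nf].
have h t (tab : t \in `]a, b[) := derivative_onP ab (subset_itv_oo_cc tab)
  (derivative_onZ (c := c) (derivable_onP (df t tab))).
split; first by move=> t tab; have [] := h t tab.
apply: iter_derivable_ext (IH _ nf) => t tab; rewrite /weighted_derivative.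
by have [_ ->] := h t tab; rewrite mulrCA.
Qed.

(** Lebesgue differentiation theorem. *)
Lemma ae_derivable_primitive (q : R -> R) : mu.-integrable `[a, b] (EFin \o q) ->
  iter_derivable 0 (fun t => \int[mu]_(s in `[a, t]) q s).
Proof.
move=> iq; pose q' := q \_ `[a, b].
have mI : measurable (`[a, b]%classic : set (measurableTypeR R)) by exact: measurable_itv.
have iq' : mu.-integrable setT (EFin \o q').
  by rewrite -restrict_EFin; apply/(integrable_mkcond _ mI).
have loc : locally_integrable setT q' by apply: open_integrable_locally => //; exact: openT.
have iy y : mu.-integrable [set` Interval (BLeft a) (BRight y)] (EFin \o q').
  by apply: integrableS iq' => //; exact: measurable_itv.
have := FTC1 iy loc; apply: (@filterS _ _ (ae_filter_ringOfSetsType mu)) => t ht tab.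
have at_ : a < t by move: tab; rewrite in_itv => /andP[].
have [|dq _] := ht; first by rewrite lte_fin.

have dq' : is_derive t (1 : R) (fun x => \int[mu]_(s in `[a, x]) q' s)
    ('D_1 (fun x => \int[mu]_(s in `[a, x]) q' s) t) by exact/derivableP.
have [d1 _] := is_derive_derivable_on tab dq'.
suff [] : derivable_on a b (fun x => \int[mu]_(s in `[a, x]) q s) t /\
  derive_on a b (fun x => \int[mu]_(s in `[a, x]) q s) t =
  derive_on a b (fun x => \int[mu]_(s in `[a, x]) q' s) t by [].
apply: derivable_on_oo_ext tab d1 => x; rewrite in_itv /= => /andP[ax xb].
apply: eq_Rintegral => s; rewrite mem_cc => /andP[as_ sx].
by rewrite /q' patchE mem_cc as_ (le_trans sx (ltW xb)).
Qed.

End IteratedDerivability.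

Section FractionalSmooth.
Context {R : realType} (a b : R) (ab : a < b) (H dH w : R -> R) (e : R).
Context (cH : clock a b H dH).
Context (wE : {in `]a, b[, forall t, w t * dH t = e}).
Context (smooth_rate : forall n, smooth_AC a b n (fun t => (dH t)^-1)).
Notation mu := (@lebesgue_measure R).

Let dH_neq0 t : t \in `[a, b] -> dH t != 0.
Proof. by move=> /(clock_rate_gt0 cH) h; rewrite gt_eqF. Qed.

Let w_def t : t \in `]a, b[ -> w t = e * (dH t)^-1.
Proof. by move=> tab; rewrite -(wE tab) mulfK // dH_neq0 // subset_itv_oo_cc. Qed.

Lemma is_derive_clock_powR c t : t \in `]a, b[ ->
  is_derive t (1 : R) (fun x => (H x - H a) `^ c) (c * (H t - H a) `^ (c - 1) * dH t).
Proof.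
move=> tab; have [at_ tb] : a < t /\ t < b by move: tab; rewrite in_itv => /andP[].
have p : 0 < H t - H a by rewrite subr_gt0 (clock_lt cH) // ltW.
have dHt := clock_is_derive cH tab.
have d1 : is_derive t (1 : R) (fun x => H x - H a) (dH t).
  by apply: is_derive_eq; rewrite /GRing.scale /=; ring.
exact: (@is_derive1_comp _ (fun y => y `^ c) (fun x => H x - H a) t _ _
  (is_derive1_powR c p) d1).
Qed.

(** Since w * dH is the constant e, the operator maps (H - H a) ^ c to
    e * c * (H - H a) ^ (c - 1). The exponent may become negative: the point a,
    where the power is singular, is excluded. *)
Lemma iter_derivable_clock_powR n c : iter_derivable a b w n (fun t => (H t - H a) `^ c).
Proof.
elim: n c => [|n IH] c.
  by apply: (@iter_derivable0 _ a b ab w _ (fun t => c * (H t - H a) `^ (c - 1) * dH t)) => t;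
    exact: is_derive_clock_powR.
apply: (@iter_derivableS _ a b ab w _ _ (fun t => c * (H t - H a) `^ (c - 1) * dH t)).
  by move=> t; exact: is_derive_clock_powR.
apply: iter_derivable_ext (iter_derivableZ ab (e * c) (IH (c - 1))) => // t tab.
by rewrite (w_def tab); field; rewrite dH_neq0 // subset_itv_oo_cc.
Qed.

Lemma smooth_AC_iter_derivable n f : smooth_AC a b n f -> iter_derivable a b w n f.
Proof.
elim: n f => [|n IH] f sf.
  have [k ik fE] := smooth_AC_primitive ab sf.
  have ik' : mu.-integrable `[a, b] (EFin \o k) by apply: integrableS ik.
  have d0 := ae_derivable_primitive ab w ik'.
  have dc : iter_derivable a b w 0 (fun=> f a).
    by apply: (@iter_derivable0 _ a b ab w _ (fun=> 0)) => t _; exact: is_derive_cst.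
  apply: iter_derivable_ext (iter_derivableD ab dc d0) => // t tab.
  exact/esym/fE/subset_itv_oo_cc.
have [_ [f' sf' df]] := sf.
apply: (iter_derivableS ab df).
have sm : smooth_AC a b n (fun t => e * (dH t)^-1 * f' t).
  exact: (smooth_ACM ab (smooth_ACM ab (smooth_AC_cst a b n e) (smooth_rate n)) sf').
by apply: iter_derivable_ext (IH _ sm) => // t tab; rewrite w_def.
Qed.

Lemma C1_primitive f f' : {within `[a, b], continuous f} -> {within `[a, b], continuous f'} ->
  {in `]a, b[, forall x : R, is_derive x (1 : R) f (f' x)} ->
  {in `[a, b], forall t, f t = f a + \int[mu]_(s in `[a, t]) f' s}.
Proof.
move=> cf cf' df t; rewrite in_itv /= => /andP[]; rewrite le_eqVlt => /predU1P[<- _|at_ tb].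
  by rewrite set_itv1 Rintegral_set1 addr0.
have sub x : x \in `]a, t[ -> x \in `]a, b[.
  by rewrite !in_itv /= => /andP[-> xt]; exact: lt_le_trans tb.
have cft := subset_cc_within (lexx a) tb cf.
rewrite /Rintegral (@continuous_FTC2 _ f' f a t at_ (subset_cc_within (lexx a) tb cf')).
- by rewrite -EFinB /= addrC subrK.
- have [_ cr cl] := (continuous_within_itvP f at_).1 cft; split => // x /sub/df dx.
  by have [] := dx.
- by move=> x /sub/df dx; rewrite derive1E; have [] := dx.
Qed.

(** By [fractional_integral_primitive] it is a primitive, up to a power of H - H a. *)
Lemma continuous_fractional_integral g phi : 0 < g -> smooth_AC a b 0 phi ->
  {within `[a, b], continuous (fractional_integral a H dH g phi)}.
Proof.
move=> g0 /(smooth_AC_primitive ab)[k ik phiE].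
have [_ iq _] := fractional_integral_primitive cH g0 (ltW ab) (lexx b) ik phiE.
apply: (@continuous_within_ext _ a b (fun t => phi a * (`|H t - H a| `^ g / g) +
    \int[mu]_(u in `[a, t]) fractional_density a H dH g k u)).
  move=> t; rewrite in_itv /= => /andP[at_ tb].
  have [_ _ ->] := fractional_integral_primitive cH g0 at_ tb ik phiE.
  by rewrite ger0_norm // subr_ge0 (clock_le cH).
have cI := parameterized_integral_continuous (ltW ab) iq.
move=> x; apply: cvgD; last exact: cI.
apply: cvgM; first exact: cvg_cst.
apply: cvgM; last exact: cvg_cst.
apply: (@continuous_cvg _ _ _ _ _ _ (fun z : R => `|z| `^ g)).
  exact: continuous_normr_powR.
by apply: cvgB; [exact: (clock_continuous cH)|exact: cvg_cst].
Qed.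

(** Write F_phi for the fractional integral of phi. If phi has a continuous
    derivative f', [fractional_integral_primitive] gives
    F_phi' = dH * (phi a * (H - H a) ^ (g - 1) + F_psi) with psi = f' / dH, so that
    the operator maps F_phi to the same combination times e. Now psi has one
    derivative less, and induction applies. At the last step F_phi is, up to a power
    of H - H a, the primitive of an integrable function. *)
Lemma iter_derivable_fractional_integral n (g : R) phi : 0 < g -> smooth_AC a b n phi ->
  iter_derivable a b w n (fractional_integral a H dH g phi).
Proof.
move=> g0; elim: n phi => [|n IH] phi sphi.
  have [k ik phiE] := smooth_AC_primitive ab sphi.
  have [_ iq _] := fractional_integral_primitive cH g0 (ltW ab) (lexx b) ik phiE.
  have d0 := ae_derivable_primitive ab w iq.
  have d1 := iter_derivableZ ab (phi a / g) (iter_derivable_clock_powR 0 g).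
  apply: iter_derivable_ext (iter_derivableD ab d1 d0) => // t.
  rewrite in_itv /= => /andP[at_ tb].
  have [_ _ ->] := fractional_integral_primitive cH g0 (ltW at_) (ltW tb) ik phiE.
  by congr (_ + _); field; rewrite gt_eqF.
have [cphi [f' sf' df]] := sphi; have {}sf' : smooth_AC a b n f' by [].
have cf' := smooth_AC_continuous sf'.
pose k := f' \_ `[a, b].
have mI : measurable (`[a, b]%classic : set (measurableTypeR R)) by exact: measurable_itv.
have ik : mu.-integrable setT (EFin \o k).
  rewrite -restrict_EFin; apply/(integrable_mkcond _ mI).
  by apply: continuous_compact_integrable => //; exact: segment_compact.
have phiE s : s \in `[a, b] -> phi s = phi a + \int[mu]_(r in `[a, s]) k r.
  move=> sab; rewrite (C1_primitive cphi cf' df sab); congr (_ + _).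
  move: sab; rewrite in_itv /= => /andP[as_ sb].
  apply: eq_Rintegral => r; rewrite mem_cc => /andP[ar rs].
  by rewrite /k patchE mem_cc ar (le_trans rs sb).
(* the derivative of phi with respect to the time H *)
pose psi t := f' t * (dH t)^-1.
have spsi : smooth_AC a b n psi by exact: smooth_ACM.
have spsi0 : smooth_AC a b 0 psi by elim: n spsi {IH sphi sf'} => // n IHn /(smooth_ACW ab).
pose q := fractional_density a H dH g k.
have [_ iq _] := fractional_integral_primitive cH g0 (ltW ab) (lexx b) ik phiE.
have qE : {in `[a, b], forall u, dH u * fractional_integral a H dH g psi u = q u}.
  move=> u uab; have := uab; rewrite in_itv /= => /andP[au ub].
  have [kp ikp psiE] := smooth_AC_primitive ab spsi0.
  have [ipsi _ _] := fractional_integral_primitive cH g0 au ub ikp psiE.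
  have mIu : measurable (`[a, u]%classic : set (measurableTypeR R)) by exact: measurable_itv.
  rewrite /fractional_integral -(RintegralZl _ mIu ipsi).
  apply: eq_Rintegral => r; rewrite mem_cc => /andP[ar ru].
  have rI : r \in `[a, b] by rewrite in_itv /= ar (le_trans ru ub).
  have -> : k r = f' r by rewrite /k patchE mem_cc ar (le_trans ru ub).
  by rewrite /psi; field; exact: dH_neq0.
have cq t : t \in `]a, b[ -> {for t, continuous q}.
  move=> tab; apply: (within_continuous_continuous ab _ tab).
  apply: (continuous_within_ext qE) => x.
  by apply: cvgM; [exact: (clock_continuous_rate cH)|exact: continuous_fractional_integral].
apply: (@iter_derivableS _ a b ab w n _
    (fun t => phi a * (g^-1 * (g * (H t - H a) `^ (g - 1) * dH t)) + q t)).
  move=> t tab; have [at_ tb] : a < t /\ t < b by move: tab; rewrite in_itv => /andP[].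
  have [dq qv] := continuous_FTC1_closed tb iq at_ (cq t tab).
  have d2 : is_derive t (1 : R) (fun x => \int[mu]_(s in `[a, x]) q s) (q t).
    by apply: DeriveDef => //; rewrite -derive1E.
  have d1 := is_derive_clock_powR g tab.
  apply: (@near_eq_is_derive _ _ _ (fun x => phi a * (g^-1 * (H x - H a) `^ g) +
      \int[mu]_(s in `[a, x]) q s)).
    have := nbhs_itv_oo tab; apply: filterS => x /=; rewrite in_itv /= => /andP[ax xb].
    have [_ _ ->] := fractional_integral_primitive cH g0 ax xb ik phiE.
    by congr (_ * _ + _); rewrite mulrC.
have n1 := iter_derivableZ ab (e * phi a) (iter_derivable_clock_powR n (g - 1)).
have n2 := iter_derivableZ ab e (IH psi spsi).
apply: iter_derivable_ext (iter_derivableD ab n1 n2) => // t tab.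
have tI := subset_itv_oo_cc tab.
rewrite -(qE t tI) (w_def tab); field; rewrite dH_neq0 //= gt_eqF //.
Qed.

End FractionalSmooth.

(** * Real powers with a sign *)

Section RealPower.
Context {R : realType}.
Implicit Types rho t : R.

Lemma sin_int_pi (c : R) : c \is a Num.int -> sin (c * pi) = 0.
Proof.
have nat_case n : sin (n%:R * pi) = 0 :> R.
  elim: n => [|n IH]; first by rewrite mul0r sin0.
  by rewrite -natr1 mulrDl mul1r sinD IH mul0r sinpi mulr0 addr0.
move=> /intrP[[n|n] ->]; first exact: nat_case.
by rewrite NegzE mulrNz mulNr sinN nat_case oppr0.
Qed.

(** An integer multiple of pi has sine 0. *)
Lemma cos_int_pi_sqr (c : R) : c \is a Num.int -> cos (c * pi) * cos (c * pi) = 1.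
Proof.
move=> ci; have := cos2Dsin2 (c * pi).
by rewrite (sin_int_pi ci) expr0n addr0 expr2.
Qed.

Lemma cosBpi (x : R) : cos (x - pi) = - cos x.
Proof. by rewrite cosB cospi sinpi mulr0 addr0 mulrN1. Qed.

Lemma rpow_rho1 t : rpow t 1 = t.
Proof.
rewrite /rpow; case: leP => t0; first by rewrite powRr1.
by rewrite powRr1 // mul1r cospi mulrN1 ltr0_norm // opprK.
Qed.

Lemma rpowr0 t : rpow t 0 = 1.
Proof. by rewrite /rpow !powRr0 mul0r cos0 mulr1 if_same. Qed.

(** For t < 0 the two signs cos ((1 - rho) pi) and cos ((rho - 1) pi) agree and
    have square 1, rho being an integer. *)
Lemma rpow_cancel rho t : t != 0 -> 0 <= t \/ rho \is a Num.int ->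
  rpow t (1 - rho) * rpow t (rho - 1) = 1.
Proof.
move=> t0 ht.
have pc (x : R) : x != 0 -> x `^ (1 - rho) * x `^ (rho - 1) = 1.
  move=> x0; rewrite -powRD ?x0 ?implybT //.
  by rewrite addrA subrK subrr powRr0.
rewrite /rpow; case: leP => tp; first exact: pc.
case: ht => [|ri]; first by rewrite leNgt tp.
rewrite mulrACA pc ?normr_eq0 // mul1r.
rewrite -opprB mulNr cosN; apply: cos_int_pi_sqr.
by rewrite rpredB // rpred1.
Qed.

Lemma regular_rpow_cancel rho t : regular_point rho t -> 0 <= t \/ rho \is a Num.int ->
  rpow t (1 - rho) * rpow t (rho - 1) = 1.
Proof.
move=> [t0|->] ht; first exact: rpow_cancel.
by rewrite subrr rpowr0 mulr1.
Qed.

(** On each side of 0 the function is a constant multiple of |t| ^ rho, and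
    cos ((rho - 1) pi) = - cos (rho pi) accounts for the sign of the derivative of
    |t| when t < 0. *)
Lemma is_derive_rpow rho t : regular_point rho t -> 0 <= t \/ rho \is a Num.int ->
  is_derive t (1 : R) (fun s => rpow s rho) (rho * rpow t (rho - 1)).
Proof.
have [->|r1] := eqVneq rho 1.
  move=> _ _; rewrite subrr rpowr0 mulr1.
  have -> : (fun s : R => rpow s 1) = id by apply/funext => s; rewrite rpow_rho1.
  exact: is_derive_id.
move=> [t0|/eqP]; last by rewrite (negPf r1).
move=> ht; have dn := is_derive_normr_powR rho t0.
have [tp|tn|t00] := ltgtP 0 t; last by rewrite t00 eqxx in t0.
  apply: (@near_eq_is_derive _ _ _ (fun y => `|y| `^ rho)).
    near=> s; have s0 : 0 < s by near: s; exact: lt_nbhsr.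
    by rewrite /rpow (ltW s0) gtr0_norm.
  by apply: (is_derive_eq dn); rewrite /rpow (ltW tp) gtr0_sg // gtr0_norm // mulr1.
apply: (@near_eq_is_derive _ _ _ (fun y => cos (rho * pi) * `|y| `^ rho)).
  near=> s; have s0 : s < 0 by near: s; exact: lt_nbhsl.
  by rewrite /rpow leNgt s0 /= mulrC.
apply: is_derive_eq; rewrite /GRing.scale /= /rpow leNgt tn /= ltr0_sg //.
by rewrite mulrBl mul1r cosBpi; ring.
Unshelve. all: by end_near. Qed.

Lemma near_regular rho t : regular_point rho t -> \forall s \near t, regular_point rho s.
Proof.
move=> [t0|->]; last by apply: (@filterE _ (nbhs t)) => s; right.
have : nbhs t [set s | s != 0] by apply: open_nbhs_nbhs; split => //; exact: open_neq.
by apply: filterS => s; left.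
Qed.

Lemma measurable_rpow (c : R) : measurable_fun setT (fun t : R => rpow t c).
Proof.
apply: measurable_fun_ifT.
- exact: measurable_fun_ler.
- exact: measurable_powR.
- apply: measurable_funM => //.
  by apply: (measurableT_comp (measurable_powR _)); exact: normr_measurable.
Qed.

End RealPower.

(** * Conjugation by the exponential *)

Section Conjugation.
Context {R : realType} (a b sigma rho : R) (ab : a < b) (hrho : rho != 0)
  (hdom : 0 <= a \/ rho \is a Num.int).
Implicit Types (t s : R) (f g : R -> R[i]).
Notation mu := (@lebesgue_measure R).

Lemma Re_real_mul (r : R) (z : R[i]) : complex.Re (r%:C * z) = r * complex.Re z.
Proof. by case: z => x y /=; rewrite mul0r subr0. Qed.

Lemma Im_real_mul (r : R) (z : R[i]) : complex.Im (r%:C * z) = r * complex.Im z.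
Proof. by case: z => x y /=; rewrite mul0r addr0. Qed.

Lemma complex_ext (z z' : R[i]) : complex.Re z = complex.Re z' ->
  complex.Im z = complex.Im z' -> z = z'.
Proof. by case: z => x y; case: z' => x' y' /= -> ->. Qed.

Lemma cintegrableZl (D : set (measurableTypeR R)) f (r : R) : measurable D ->
  cintegrable D f -> cintegrable D (fun s => r%:C * f s).
Proof.
move=> mD [iR iI]; split.
  apply: (eq_integrable mD _ _ _ (integrableZl mD r iR)) => s _ /=.
  by rewrite Re_real_mul EFinM.
apply: (eq_integrable mD _ _ _ (integrableZl mD r iI)) => s _ /=.
by rewrite Im_real_mul EFinM.
Qed.

Lemma cintegralZl (D : set (measurableTypeR R)) f (r : R) : measurable D ->
  cintegrable D f -> cintegral D (fun s => r%:C * f s) = r%:C * cintegral D f.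
Proof.
move=> mD [iR iI]; apply: complex_ext; rewrite ?Re_real_mul ?Im_real_mul /=.
  rewrite -(RintegralZl _ mD iR); apply: eq_Rintegral => s _; exact: Re_real_mul.
rewrite -(RintegralZl _ mD iI); apply: eq_Rintegral => s _; exact: Im_real_mul.
Qed.

Let E t := expR (- sigma * rpow t rho).

(** exp (- sigma (t ^ rho - s ^ rho)) splits into a factor that depends on t only
    and a factor that is absorbed by the integrand. *)
Lemma substantial_kernelE gamma (psi : R -> R) t s :
  substantial_kernel sigma gamma rho psi t s = (E t)%:C *
    katugampola_kernel gamma rho (fun s => expR (sigma * rpow s rho) * psi s) t s.
Proof.
rewrite /substantial_kernel /katugampola_kernel mulrCA; congr (_ * _).
rewrite -rmorphM /=; congr (_%:C).
rewrite mulrBr expRD -mulNr opprK /E; ring.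
Qed.

(** Multiplying by a nonzero constant does not affect integrability. *)
Lemma substantial_I_existsE gamma (psi : R -> R) t :
  substantial_I_exists sigma gamma rho a psi t <->
  katugampola_I_exists gamma rho a (fun s => expR (sigma * rpow s rho) * psi s) t.
Proof.
have mI : measurable (`[a, t]%classic : set (measurableTypeR R)) by exact: measurable_itv.
have -> : substantial_I_exists sigma gamma rho a psi t = (gamma = 0 \/
    cintegrable `[a, t] (fun s => (E t)%:C * katugampola_kernel gamma rho
      (fun s => expR (sigma * rpow s rho) * psi s) t s)).
  rewrite /substantial_I_exists; congr (_ \/ cintegrable _ _).
  by apply/funext => s; exact: substantial_kernelE.
split=> [[->|ci]|[->|ci]]; [by left| |by left|]; right; last exact: cintegrableZl.
have := cintegrableZl (E t)^-1 mI ci; congr cintegrable; apply/funext => s.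
by rewrite mulrA -rmorphM /= mulVf ?mul1r // gt_eqF // expR_gt0.
Qed.

Lemma substantial_IE gamma (psi : R -> R) t :
  let psi' := fun s : R => expR (sigma * rpow s rho) * psi s in
  katugampola_I_exists gamma rho a psi' t ->
  substantial_I sigma gamma rho a psi t = (E t)%:C * katugampola_I gamma rho a psi' t.
Proof.
move=> psi'; rewrite /katugampola_I_exists /substantial_I /katugampola_I.
have mI : measurable (`[a, t]%classic : set (measurableTypeR R)) by exact: measurable_itv.
case: eqVneq => [_ _|g0 [/eqP|ci]]; last 2 first.
- by rewrite (negPf g0).
- rewrite mulrCA; congr (_ * _); rewrite -(cintegralZl _ mI ci); congr cintegral.
  by apply/funext => s; exact: substantial_kernelE.
by rewrite -rmorphM /psi' /= mulrA /E -expRD mulNr addrC subrr expR0 mul1r.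
Qed.

End Conjugation.

Section IteratedConjugation.
Context {R : realType} (a b sigma rho : R) (ab : a < b) (hrho : rho != 0)
  (hdom : 0 <= a \/ rho \is a Num.int).
Implicit Types (t s tau : R) (F G : R -> R[i]).

Let ex tau t : R := expR (tau * rpow t rho).

Lemma dom_point t : t \in `[a, b] -> 0 <= t \/ rho \is a Num.int.
Proof.
rewrite in_itv /= => /andP[at_ _]; case: hdom => [a0|]; last by right.
by left; exact: le_trans at_.
Qed.

Lemma derivative_on_expR_rpow tau t : t \in `[a, b] -> regular_point rho t ->
  derivative_on a b (ex tau) t (tau * (rho * rpow t (rho - 1)) * ex tau t).
Proof.
move=> tab rt; apply: is_derive_derivative_on.
have d1 := is_derive_rpow rt (dom_point tab).
have d2 : is_derive t (1 : R) (fun s => tau * rpow s rho) (tau * (rho * rpow t (rho - 1))).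
  by apply: is_derive_eq; rewrite /GRing.scale /=; ring.
have := @is_derive1_comp _ expR (fun s => tau * rpow s rho) t _ _ (is_derive_expR _) d2.
by rewrite mulrC.
Qed.

(** The product rule. *)
Lemma cderive_on_expR_mul tau F G t : t \in `[a, b] -> regular_point rho t ->
  (\forall s \near within `[a, b] (nbhs t), F s = (ex tau s)%:C * G s) ->
  F t = (ex tau t)%:C * G t -> cderivable_on a b G t ->
  cderivable_on a b F t /\
  cderive_on a b F t = (tau * (rho * rpow t (rho - 1)) * ex tau t)%:C * G t +
    (ex tau t)%:C * cderive_on a b G t.
Proof.
move=> tab rt nF Ft [/derivable_onP dR /derivable_onP dI].
have dE := @derivative_on_expR_rpow tau t tab rt.
have [cR ER] : derivable_on a b (fun s => complex.Re (F s)) t /\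
    derive_on a b (fun s => complex.Re (F s)) t =
    tau * (rho * rpow t (rho - 1)) * ex tau t * complex.Re (G t) +
    ex tau t * derive_on a b (fun s => complex.Re (G s)) t.
  apply: (derivative_onP ab tab).
  apply: derivative_on_ext (derivative_onM dE dR); last by rewrite Ft Re_real_mul.
  by move: nF; rewrite !near_withinE; apply: filterS => s Fs /Fs ->; rewrite Re_real_mul.
have [cI EI] : derivable_on a b (fun s => complex.Im (F s)) t /\
    derive_on a b (fun s => complex.Im (F s)) t =
    tau * (rho * rpow t (rho - 1)) * ex tau t * complex.Im (G t) +
    ex tau t * derive_on a b (fun s => complex.Im (G s)) t.
  apply: (derivative_onP ab tab).
  apply: derivative_on_ext (derivative_onM dE dI); last by rewrite Ft Im_real_mul.
  by move: nF; rewrite !near_withinE; apply: filterS => s Fs /Fs ->; rewrite Im_real_mul.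
split; first by split.
apply: complex_ext; rewrite /cderive_on /=.
  by rewrite ER; case: (G t) => x y /=; rewrite !mul0r !subr0.
by rewrite EI; case: (G t) => x y /=; rewrite !mul0r !addr0.
Qed.

(** Let E = exp (- sigma t ^ rho). Since (t ^ (1 - rho) / rho) d/dt maps t ^ rho to
    1, it maps E to - sigma E, and the product rule shows that the operator with
    + sigma, applied to E f, is E times the operator without sigma applied to f. The
    converse implication between existence statements multiplies by 1 / E. *)
Lemma iter_conjugation (domS domK : R -> Prop) (S K : R -> R[i]) n t :
  (forall s, domS s <-> domK s) ->
  (forall s, domK s -> S s = (ex (- sigma) s)%:C * K s) ->
  t \in `[a, b] -> regular_point rho t ->
  (iter_exists a b (subst_step sigma rho a b) domS n S t <->
   iter_exists a b (kat_step rho a b) domK n K t) /\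
  (iter_exists a b (kat_step rho a b) domK n K t ->
   iter n (subst_step sigma rho a b) S t =
   (ex (- sigma) t)%:C * iter n (kat_step rho a b) K t).
Proof.
move=> domE SE; elim: n t => [|n IH] t tab rt /=; first by split; [exact: domE|exact: SE].
set Sn := iter n _ S; set Kn := iter n _ K.
have nIH : \forall s \near within `[a, b] (nbhs t),
    (iter_exists a b (subst_step sigma rho a b) domS n S s <->
     iter_exists a b (kat_step rho a b) domK n K s) /\
    (iter_exists a b (kat_step rho a b) domK n K s -> Sn s = (ex (- sigma) s)%:C * Kn s).
  rewrite near_withinE; have := near_regular rt; apply: filterS => s rs sab.
  exact: IH.
have center (P : R -> Prop) : (\forall s \near within `[a, b] (nbhs t), P s) -> P t.
  by rewrite near_withinE => /nbhs_singleton; exact.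
have nE : (\forall s \near within `[a, b] (nbhs t),
      iter_exists a b (kat_step rho a b) domK n K s) ->
    \forall s \near within `[a, b] (nbhs t), Sn s = (ex (- sigma) s)%:C * Kn s.
  by move: nIH; apply: filterS2 => s [_]; apply.
have nE' : (\forall s \near within `[a, b] (nbhs t),
      iter_exists a b (kat_step rho a b) domK n K s) ->
    \forall s \near within `[a, b] (nbhs t), Kn s = (ex sigma s)%:C * Sn s.
  move=> /nE; apply: filterS => s ->.
  by rewrite mulrA -rmorphM /ex -expRD mulNr subrr expR0 mul1r.
have conv : (\forall s \near within `[a, b] (nbhs t),
      iter_exists a b (subst_step sigma rho a b) domS n S s) <->
    \forall s \near within `[a, b] (nbhs t), iter_exists a b (kat_step rho a b) domK n K s.
  by split; move: nIH; apply: filterS2 => s [[h1 h2] _].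
split; first split=> [[/conv hn hd]|[hn hd]].
- by split=> //; have [] := cderive_on_expR_mul tab rt (nE' hn) (center _ (nE' hn)) hd.
- split; first exact/conv.
  by have [] := cderive_on_expR_mul tab rt (nE hn) (center _ (nE hn)) hd.
move=> [hn hd].
have [_ dS] := cderive_on_expR_mul tab rt (nE hn) (center _ (nE hn)) hd.
rewrite {1}/subst_step dS (center _ (nE hn)) /kat_step.
have pr := regular_rpow_cancel rt (dom_point tab).
have key : (rpow t (1 - rho) / rho)%:C *
    (- sigma * (rho * rpow t (rho - 1)) * ex (- sigma) t)%:C = (- sigma * ex (- sigma) t)%:C.
  rewrite -rmorphM /=; congr (_%:C).
  transitivity (- sigma * ex (- sigma) t * (rpow t (1 - rho) * rpow t (rho - 1))).
    by field.
  by rewrite pr mulr1.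
rewrite mulrDr mulrA key !rmorphM rmorphN /=.
move: (cderive_on _ _ _ _) (Kn t) (sigma%:C) ((ex _ t)%:C) (_%:C) => x y z u v.
by ring.
Qed.

End IteratedConjugation.

(** * Existence of the Katugampola derivative *)

Section KatugampolaExists.
Context {R : realType} (a b rho : R) (ab : a < b).
Notation mu := (@lebesgue_measure R).
Implicit Types (f : R -> R) (F : R -> R[i]).

Let w t : R := rpow t (1 - rho) / rho.
Notation L := (kat_step rho a b).

Lemma iter_kat_stepE n F :
  (fun t => complex.Re (iter n L F t)) =
    iter n (weighted_derivative a b w) (fun t => complex.Re (F t)) /\
  (fun t => complex.Im (iter n L F t)) =
    iter n (weighted_derivative a b w) (fun t => complex.Im (F t)).
Proof.
elim: n => [//|n [IHR IHI]] /=; rewrite -IHR -IHI.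
by split; apply/funext => t; rewrite mul0r ?subr0 ?addr0.
Qed.

Lemma iter_derivable_lt n f k t : iter_derivable a b w n f -> (k < n)%N ->
  t \in `]a, b[ -> derivable_on a b (iter k (weighted_derivative a b w) f) t.
Proof.
elim: n f k => [//|n IH] f [|k] [df nf] kn tab; first exact: df.
by rewrite iterSr; exact: IH.
Qed.

Lemma iter_derivable_ae n f : iter_derivable a b w n f ->
  {ae mu, forall t, t \in `]a, b[ ->
    derivable_on a b (iter n (weighted_derivative a b w) f) t}.
Proof. by elim: n f => [//|n IH] f [_ /IH]; rewrite iterSr. Qed.

(** The operator acts on real and imaginary parts separately, since its coefficient
    is real. *)
Lemma kat_iter_exists n (dom : R -> Prop) F : {in `]a, b[, forall t, dom t} ->
  iter_derivable a b w n (fun t => complex.Re (F t)) ->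
  iter_derivable a b w n (fun t => complex.Im (F t)) ->
  {ae mu, forall t, t \in `]a, b[ -> iter_exists a b L dom n.+1 F t}.
Proof.
move=> hdom nR nI.
have low k t : (k <= n)%N -> t \in `]a, b[ -> iter_exists a b L dom k F t.
  elim: k t => [|k IH] t kn tab; first exact: hdom.
  split.
    rewrite near_withinE; have : nbhs t `]a, b[%classic.
      by apply: open_nbhs_nbhs; split => //; exact: interval_open.
    by apply: filterS => s sab _; apply: IH => //; exact: ltnW.
  have [eR eI] := iter_kat_stepE k F.
  by split; [rewrite eR|rewrite eI]; exact: iter_derivable_lt kn tab.
have [eR eI] := iter_kat_stepE n F.
have := iter_derivable_ae nR; have := iter_derivable_ae nI.
apply: (@filterS2 _ _ (ae_filter_ringOfSetsType mu)) => t hI hR tab; split; last first.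
  by split; [rewrite eR; exact: hR|rewrite eI; exact: hI].
rewrite near_withinE; have : nbhs t `]a, b[%classic.
  by apply: open_nbhs_nbhs; split => //; exact: interval_open.
by apply: filterS => s sab _; exact: low.
Qed.

(** The two end points form a null set. *)
Lemma ae_itv_oo_cc (P : R -> Prop) : {ae mu, forall t, t \in `]a, b[ -> P t} ->
  {ae mu, forall t, t \in `[a, b] -> P t}.
Proof.
move=> hP.
have ne (c : R) : {ae mu, forall t, t != c}.
  exists [set c]; split; [exact: measurable_set1|exact: lebesgue_measure_set1|].
  by move=> t /= /negP/negPn/eqP.
have := ne b; move: hP (ne a).
apply: (@filterS3 _ _ (ae_filter_ringOfSetsType mu)) => t hP ta tb tab; apply: hP.
move: tab; rewrite !in_itv /= => /andP[h1 h2].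
by rewrite !lt_neqAle h1 h2 tb eq_sym ta.
Qed.

End KatugampolaExists.

Section PowerClock.
Context {R : realType} (a b rho : R) (ab : a < b) (hrho : rho != 0)
  (hdom : 0 <= a \/ rho \is a Num.int)
  (hreg : forall t : R, t \in `[a, b] -> regular_point rho t).

Definition power_rate (t : R) : R := `|rho| * `|t| `^ (rho - 1).

Lemma regular_itv : rho = 1 \/ 0 \notin `[a, b].
Proof.
have [->|r1] := eqVneq rho 1; [by left|right].
by apply/negP => /hreg[|/eqP]; [rewrite eqxx|rewrite (negPf r1)].
Qed.

(** The sign of rho * rpow t (rho - 1) does not change on an interval that avoids 0:
    for t < 0 the exponent is an integer and cos ((rho - 1) pi) is 1 or -1. *)
Lemma power_rate_sign : exists2 eps : R, eps = 1 \/ eps = -1 &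
  {in `[a, b], forall t, eps * (rho * rpow t (rho - 1)) = power_rate t}.
Proof.
case: regular_itv => [r1|ab0].
  exists 1; first by left.
  by move=> t _; rewrite /power_rate r1 subrr rpowr0 powRr0 normr1 !mulr1.
have sg_rho : Num.sg rho = 1 \/ Num.sg rho = -1.
  by have [r0|r0|r0] := sgrP rho; [move: hrho; rewrite r0 eqxx|left|right].
have [a0|a0] := ltP 0 a.
  exists (Num.sg rho) => // t; rewrite in_itv /= => /andP[at_ _].
  have t0 := lt_le_trans a0 at_.
  by rewrite /power_rate /rpow (ltW t0) (gtr0_norm t0) mulrA [`|rho|]normrEsg.
have b0 : b < 0.
  by rewrite ltNge; apply/negP => b0; rewrite in_itv /= a0 b0 in ab0.
have ri : rho \is a Num.int.
  case: hdom => // a0'; have := lt_trans ab b0; rewrite ltNge a0' //.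
have cc : cos ((rho - 1) * pi) * cos ((rho - 1) * pi) = 1.
  by apply: cos_int_pi_sqr; rewrite rpredB // rpred1.
have c1 : cos ((rho - 1) * pi) = 1 \/ cos ((rho - 1) * pi) = -1.
  have /eqP : (cos ((rho - 1) * pi) - 1) * (cos ((rho - 1) * pi) + 1) = 0.
    by rewrite -subr_sqr expr2 cc expr1n subrr.
  by rewrite mulf_eq0 subr_eq0 addr_eq0 => /orP[] /eqP; [left|right].
exists (Num.sg rho * cos ((rho - 1) * pi)).
  by case: sg_rho => ->; case: c1 => ->; rewrite ?mulN1r ?opprK ?mul1r; [left|right|right|left].
move=> t; rewrite in_itv /= => /andP[_ tb].
have t0 := le_lt_trans tb b0.
rewrite /power_rate /rpow leNgt t0 /= [`|rho| in RHS]normrEsg.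
transitivity (Num.sg rho * rho * `|t| `^ (rho - 1) *
  (cos ((rho - 1) * pi) * cos ((rho - 1) * pi))); first by ring.
by rewrite cc mulr1.
Qed.

Lemma smooth_AC_powR n c : rho = 1 /\ c = 0 \/ 0 \notin `[a, b] ->
  smooth_AC a b n (fun t : R => `|t| `^ c).
Proof.
case=> [[_ ->]|ab0]; last exact: smooth_AC_normr_powR.
have -> : (fun t : R => `|t| `^ 0) = (fun=> 1) by apply/funext => t; rewrite powRr0.
exact: smooth_AC_cst.
Qed.

Lemma smooth_AC_power_rate n : smooth_AC a b n power_rate.
Proof.
apply: (smooth_ACM ab (smooth_AC_cst a b n `|rho|)); apply: smooth_AC_powR.
by case: regular_itv => [->|h]; [left; rewrite subrr|right].
Qed.

Lemma smooth_AC_power_rateV n : smooth_AC a b n (fun t => (power_rate t)^-1).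
Proof.
have -> : (fun t => (power_rate t)^-1) = (fun t => `|rho|^-1 * `|t| `^ (- (rho - 1))).
  by apply/funext => t; rewrite /power_rate invfM powRN.
apply: (smooth_ACM ab (smooth_AC_cst a b n `|rho|^-1)); apply: smooth_AC_powR.
by case: regular_itv => [->|h]; [left; rewrite subrr oppr0|right].
Qed.

Lemma clock_rpow (eps : R) :
  {in `[a, b], forall t, eps * (rho * rpow t (rho - 1)) = power_rate t} ->
  clock a b (fun t => eps * rpow t rho) power_rate.
Proof.
move=> epsE.
have d t : t \in `[a, b] ->
    is_derive t (1 : R) (fun t => eps * rpow t rho) (power_rate t).
  move=> tab; rewrite -(epsE t tab).
  have := is_derive_rpow (hreg tab) (dom_point hdom tab).
  by move=> dr; apply: is_derive_eq; rewrite /GRing.scale /=; ring.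
split.
- by apply: measurable_funM => //; exact: measurable_rpow.
- apply: measurable_funM => //.
  by apply: (measurableT_comp (measurable_powR _)); exact: normr_measurable.
- apply: continuous_in_subspaceT => t; rewrite in_setE => /d[dt _].
  exact/differentiable_continuous/derivable1_diffP.
- by move=> t tab; apply: d; exact: subset_itv_oo_cc.
- exact: smooth_AC_continuous (smooth_AC_power_rate 0).
move=> t tab; rewrite mulr_gt0 ?normr_gt0 //.
have [t0|->] := hreg tab; first by rewrite powR_gt0 // normr_gt0.
by rewrite subrr powRr0.
Qed.

End PowerClock.

Section KernelPhase.
Context {R : realType} (a b rho : R) (ab : a < b) (hrho : rho != 0)
  (hdom : 0 <= a \/ rho \is a Num.int)
  (hreg : forall t : R, t \in `[a, b] -> regular_point rho t)
  (eps : R) (eps1 : eps = 1 \/ eps = -1)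
  (epsE : {in `[a, b], forall t, eps * (rho * rpow t (rho - 1)) = power_rate rho t}).
Notation mu := (@lebesgue_measure R).
Let H (t : R) := eps * rpow t rho.
Let dH := power_rate rho.

Lemma Re_mul_real (z : R[i]) (r : R) : complex.Re (z * r%:C) = complex.Re z * r.
Proof. by rewrite mulrC Re_real_mul mulrC. Qed.

Lemma Im_mul_real (z : R[i]) (r : R) : complex.Im (z * r%:C) = complex.Im z * r.
Proof. by rewrite mulrC Im_real_mul mulrC. Qed.

(** When eps = -1 the difference x - y is nonpositive and its principal power has a
    constant phase, except when x = y, where both sides vanish because c != 0. *)
Lemma cpow_phase c : c != 0 -> exists z : R[i], forall x y : R,
  0 <= eps * x - eps * y -> cpow (x - y) c = z * ((eps * x - eps * y) `^ c)%:C.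
Proof.
move=> c0; case: eps1 => ->.
  exists 1 => x y; rewrite !mul1r => xy; rewrite /cpow xy ger0_norm //.
  by rewrite mulr1.
exists (cos (c * pi) +i* sin (c * pi)) => x y; rewrite !mulN1r opprK addrC subr_ge0.
rewrite le_eqVlt => /predU1P[->|xy].
  by rewrite /cpow subrr lexx normr0 powR0 // mul0r mulr0.
rewrite /cpow subr_ge0 leNgt xy /= mulrC; congr (_ * _); congr (_%:C).
by rewrite ltr0_norm ?subr_lt0 // opprB.
Qed.

(** On the domain of integration t ^ rho - s ^ rho keeps a constant sign, so the
    complex kernel is a constant complex number times the real kernel of
    [fractional_integral] for the time change eps * t ^ rho. *)
Lemma katugampola_I_fractional (g : R) (psi : R -> R) (n : nat) :
  0 < g -> g < 1 -> smooth_AC a b n psi ->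
  {in `[a, b], forall t, katugampola_I_exists g rho a psi t} /\
  exists z : R[i], {in `[a, b], forall t,
    katugampola_I g rho a psi t = z * (fractional_integral a H dH g psi t)%:C}.
Proof.
move=> g0 g1 spsi.
have cH : clock a b H dH by exact: clock_rpow.
have [k ik psiE] := smooth_AC_primitive ab spsi.
have [z0 z0E] : exists z : R[i], forall x y : R,
    0 <= eps * x - eps * y -> cpow (x - y) (g - 1) = z * ((eps * x - eps * y) `^ (g - 1))%:C.
  by apply: cpow_phase; rewrite subr_eq0 lt_eqF.
pose z := z0 * (eps / rho)%:C.
pose K t s := (H t - H s) `^ (g - 1) * (dH s * psi s).
have kE t s : t \in `[a, b] -> s \in `[a, t]%classic ->
    katugampola_kernel g rho psi t s = z * (K t s)%:C.
  rewrite in_itv mem_cc /= => /andP[at_ tb] /andP[as_ st].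
  have sab : s \in `[a, b] by rewrite in_itv /= as_ (le_trans st tb).
  have Hst : 0 <= eps * rpow t rho - eps * rpow s rho.
    by rewrite subr_ge0; exact: (clock_le cH).
  rewrite /katugampola_kernel z0E // /z /K -!mulrA; congr (_ * _).
  rewrite -!rmorphM /=; congr (_%:C).
  have ee : eps * eps = 1 by case: eps1 => ->; rewrite ?mulr1 // mulrNN mulr1.
  rewrite [`|rho| * _]mulrA -/(power_rate rho s) -(epsE sab) /H.
  transitivity ((eps * rpow t rho - eps * rpow s rho) `^ (g - 1) *
    ((eps * eps) * (psi s * rpow s (rho - 1)))); first by rewrite ee mul1r.
  by field.
clearbody z.
have iK t : t \in `[a, b] -> mu.-integrable `[a, t] (EFin \o K t).
  rewrite in_itv /= => /andP[at_ tb].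
  by have [] := fractional_integral_primitive cH g0 at_ tb ik psiE.
split.
  move=> t tab; right.
  have mI : measurable (`[a, t]%classic : set (measurableTypeR R)) by exact: measurable_itv.
  split.
    apply: (eq_integrable mI _ _ _ (integrableZl mI (complex.Re z) (iK t tab))) => s sI /=.
    by rewrite (kE t s tab sI) Re_mul_real.
  apply: (eq_integrable mI _ _ _ (integrableZl mI (complex.Im z) (iK t tab))) => s sI /=.
  by rewrite (kE t s tab sI) Im_mul_real.
exists ((rho / Gamma g)%:C * z) => t tab.
have mI : measurable (`[a, t]%classic : set (measurableTypeR R)) by exact: measurable_itv.
rewrite /katugampola_I gt_eqF // -mulrA; congr (_ * _).
apply: complex_ext; rewrite ?Re_mul_real ?Im_mul_real /=.
  rewrite /fractional_integral -(RintegralZl _ mI (iK t tab)).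
  by apply: eq_Rintegral => s sI; rewrite (kE t s tab sI) Re_mul_real.
rewrite /fractional_integral -(RintegralZl _ mI (iK t tab)).
by apply: eq_Rintegral => s sI; rewrite (kE t s tab sI) Im_mul_real.
Qed.

End KernelPhase.

(** For order 0 the integral is the identity and absolute continuity of the last
    derivative is enough; otherwise the fractional integral is differentiated. *)
Lemma katugampola_D_exists_ae (R : realType) (a b rho alpha : R) (n : nat) (psi : R -> R) :
  a < b -> rho != 0 -> 0 <= a \/ rho \is a Num.int ->
  (forall t : R, t \in `[a, b] -> regular_point rho t) ->
  n%:R < alpha <= n.+1%:R -> smooth_AC a b n psi ->
  {ae lebesgue_measure, forall t : R, t \in `[a, b] ->
     katugampola_D_exists n.+1 alpha rho a b psi t}.
Proof.
move=> ab hrho hdom hreg /andP[na an] spsi.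
set g := n.+1%:R - alpha.
have g0 : 0 <= g by rewrite subr_ge0.
have g1 : g < 1 by rewrite /g -natr1 ltrBlDr addrC ltrD2l.
have [eps eps1 epsE] := power_rate_sign ab hrho hdom hreg.
have cH := clock_rpow ab hrho hdom hreg epsE.
pose w t : R := rpow t (1 - rho) / rho.
have wE : {in `]a, b[, forall t, w t * power_rate rho t = eps}.
  move=> t /subset_itv_oo_cc tab; rewrite -epsE //.
  have pr := regular_rpow_cancel (hreg t tab) (dom_point hdom tab).
  transitivity (eps * (rpow t (1 - rho) * rpow t (rho - 1))); last by rewrite pr mulr1.
  by rewrite /w; field.
have sV k := smooth_AC_power_rateV ab hreg k.
apply: ae_itv_oo_cc => //; rewrite /katugampola_D_exists.
have [g00|gn0] := eqVneq g 0.
  apply: kat_iter_exists => //; first by move=> t _; left.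
    apply: iter_derivable_ext (smooth_AC_iter_derivable ab cH wE sV spsi) => // t _.
    by rewrite /katugampola_I -/g g00 eqxx.
  apply: iter_derivable_ext (smooth_AC_iter_derivable ab cH wE sV (smooth_AC_cst a b n 0)) => // t _.
  by rewrite /katugampola_I -/g g00 eqxx.
have gp : 0 < g by rewrite lt_neqAle eq_sym gn0.
have [ex [z zE]] := katugampola_I_fractional ab hrho hdom hreg eps1 epsE gp g1 spsi.
have nF := iter_derivable_fractional_integral ab cH wE sV gp spsi.
apply: kat_iter_exists => //.
- by move=> t tab; apply: ex; exact: subset_itv_oo_cc.
- apply: iter_derivable_ext (iter_derivableZ ab (complex.Re z) nF) => // t tab.
  by rewrite zE ?Re_mul_real // subset_itv_oo_cc.
- apply: iter_derivable_ext (iter_derivableZ ab (complex.Im z) nF) => // t tab.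
  by rewrite zE ?Im_mul_real // subset_itv_oo_cc.
Qed.

Unset Implicit Arguments.
Set Strict Implicit.
Set Printing Implicit Defensive.

Theorem theorem2 (R : realType) (a b sigma rho alpha : R) (m : nat)
    (psi : R -> R) (hab : a < b) (hrho : rho != 0)
    (hdom : 0 <= a \/ rho \is a Num.int)
    (hm : (0 < m)%N) (halpha : m.-1%:R < alpha <= m%:R)
    (hpsi : Omega m sigma rho a b psi) :
  let psi' := fun s : R => expR (sigma * rpow s rho) * psi s in
  [/\ forall t : R, t \in `[a, b] -> regular_point rho t ->
        (substantial_D_exists m sigma alpha rho a b psi t <->
         katugampola_D_exists m alpha rho a b psi' t),
      forall t : R, t \in `[a, b] -> regular_point rho t ->
        substantial_D_exists m sigma alpha rho a b psi t ->
        substantial_D m sigma alpha rho a b psi t =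
        (expR (- sigma * rpow t rho))%:C *
        katugampola_D m alpha rho a b psi' t
    & (forall t : R, t \in `[a, b] -> regular_point rho t) ->
      {ae lebesgue_measure, forall t : R, t \in `[a, b] ->
        substantial_D_exists m sigma alpha rho a b psi t}].
Proof.
move=> psi'.
have conj t (tab : t \in `[a, b]) (rt : regular_point rho t) :=
  iter_conjugation hab hrho hdom m
    (substantial_I_existsE a sigma rho (m%:R - alpha) psi)
    (@substantial_IE R a sigma rho (m%:R - alpha) psi) tab rt.
split=> [t tab rt|t tab rt|hreg].
- by have [] := conj t tab rt.
- by have [h1 h2] := conj t tab rt; move=> /h1 /h2.
have : {ae lebesgue_measure, forall t : R, t \in `[a, b] ->
    katugampola_D_exists m alpha rho a b psi' t}.
  case: m hm halpha hpsi {conj} => // n _ halpha [g gAC gE].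
  apply: katugampola_D_exists_ae => //.
  have [eps eps1 epsE] := power_rate_sign hab hrho hdom hreg.
  have ee : eps * eps = 1 by case: eps1 => ->; rewrite ?mulr1 // mulrNN mulr1.
  apply: (@smooth_AC_ext _ a b n (fun t => eps / rho * (power_rate rho t * g t))).
    move=> t tab; rewrite (gE t tab (hreg t tab)) -(epsE t tab) /psi'.
    have pr := regular_rpow_cancel (hreg t tab) (dom_point hdom tab).
    transitivity ((eps * eps) * (rpow t (1 - rho) * rpow t (rho - 1)) *
      (expR (sigma * rpow t rho) * psi t)); first by field.
    by rewrite ee pr !mul1r.
  apply: (smooth_ACM hab (smooth_AC_cst a b n _)).
  by apply: (smooth_ACM hab (smooth_AC_power_rate hab hreg n)); exact: ACm_smooth_AC.
apply: (@filterS _ _ (ae_filter_ringOfSetsType lebesgue_measure)) => t ht tab.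
by have [[_ h] _] := conj t tab (hreg t tab); apply: h; exact: ht.
Qed.
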